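(* Fix $2\le d\le 7$. Then $\lim_{n\to\infty}\mu^w_{n,d}$ exists (in the local weak sense) for all good weight sequences $w$ and is independent of $w$. In particular, $\lim_{n\to\infty}\mu^{\{-k,\dots,k\}}_{n,d}$ exists for all integers $k\ge0$ and is independent of $k$.
   Context: A $d$-ary tree $\mathbb{T}_d$ is an infinite tree with root $\rho$ of degree $d$ and all other vertices of degree $d+1$; $\mathbb{T}^n_d$ is the subtree induced by vertices within distance $n$ of $\rho$, and its leaves are the vertices at distance exactly $n$. A $1$-Lipschitz function is an integer-valued $f$ with $|f(u)-f(v)|\le1$ for adjacent $u,v$. A sequence $w=(w(i))_{i\in\mathbb{Z}}\in[0,\infty)^{\mathbb{Z}}$ is good if $w(i)=w(-i)$ for all $i$, $w(0)>0$, and there exist an integer $k\ge0$ and $c\in[0,1)$ with $w(i)=w(i+1)$ for all $0\le i<k$ and $w(i+1)\le c\,w(i)$ for all $i\ge k$. $\mu^w_{n,d}$ is the probability measure on $1$-Lipschitz functions on $\mathbb{T}^n_d$ giving each such $f$ weight proportional to $\prod_{v\text{ leaf}}w(f(v))$. $\mu^{\{-k,\dots,k\}}_{n,d}$ is the uniform measure on $1$-Lipschitz functions on $\mathbb{T}^n_d$ whose leaf values lie in $\{-k,\dots,k\}$. Local weak convergence: for each $r\ge0$ the law of the restriction of $f$ to vertices within distance $r$ of $\rho$ converges to a probability measure. *)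

(* Defs.v *)
From HB Require Import structures.
From mathcomp Require Import all_boot all_order all_algebra.
From mathcomp Require Import all_classical all_reals all_analysis.
Set Implicit Arguments. Unset Strict Implicit. Unset Printing Implicit Defensive.
Import Order.TTheory GRing.Theory Num.Theory.
Local Open Scope classical_set_scope.
Local Open Scope ring_scope.

(* Vertices of the d-ary tree T_d: finite words over 'I_d; the root is [::],
   the children of a word u are the words i :: u (i : 'I_d).
   The distance of u to the root is size u.
   Vertices of T^n_d (the ball of radius n) : the type n.-bseq 'I_d. *)
Definition vtx (n d : nat) := n.-bseq 'I_d.

Definition is_child (d : nat) (u v : seq 'I_d) : bool :=
  (size v == (size u).+1) && (behead v == u).

Definition tfun (n d : nat) := {ffun vtx n d -> int}.

Definition lipschitz (n d : nat) (f : tfun n d) : Prop :=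
  forall u v : vtx n d, is_child (val u) (val v) -> `|f u - f v| <= 1.

Definition Lip (n d : nat) : set (tfun n d) := [set f | lipschitz f].
Arguments Lip n d : clear implicits.

Definition is_leaf (n d : nat) (v : vtx n d) : bool := size v == n.

Definition good (R : realType) (w : int -> R) : Prop :=
  [/\ forall i, 0 <= w i,
      forall i, w i = w (- i),
      0 < w 0 &
      exists (k : nat) (c : R), [/\ 0 <= c, c < 1,
        forall i : nat, (i < k)%N -> w i%:Z = w (i.+1)%:Z &
        forall i : nat, (k <= i)%N -> w (i.+1)%:Z <= c * w i%:Z]].

Definition weight (R : realType) (n d : nat) (w : int -> R) (f : tfun n d) : R :=
  \prod_(v : vtx n d | is_leaf v) w (f v).

Definition restr_eq (n d r : nat) (g : tfun r d) : set (tfun n d) :=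
  [set f | forall (u : vtx r d) (v : vtx n d), val u = val v -> f v = g u].

(* mu^w_{n,d}(f|_{B_r} = g) : ratio of (countable) sums of weights over
   1-Lipschitz functions *)
Definition muw (R : realType) (d : nat) (w : int -> R) (n r : nat) (g : tfun r d) : R :=
  fine (\esum_(f in Lip n d `&` @restr_eq n d r g) (weight w f)%:E) /
  fine (\esum_(f in Lip n d) (weight w f)%:E).

Definition Lipk (n d k : nat) : set (tfun n d) :=
  [set f | lipschitz f /\ forall v : vtx n d, is_leaf v -> `|f v| <= k%:Z].
Arguments Lipk n d k : clear implicits.

Definition muk (R : realType) (d k n r : nat) (g : tfun r d) : R :=
  fine (\esum_(f in Lipk n d k `&` @restr_eq n d r g) (1%E : \bar R)) /
  fine (\esum_(f in Lipk n d k) (1%E : \bar R)).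

(* nu is a family (indexed by the radius r) of probability measures on
   configurations on the ball of radius r (a countable discrete space) *)
Definition prob_family (R : realType) (d : nat) (nu : forall r : nat, tfun r d -> R) : Prop :=
  forall r, (forall g, 0 <= nu r g) /\ \esum_(g in [set: tfun r d]) (nu r g)%:E = 1%E.

(* Main.v *)
Require Import Defs.
From HB Require Import structures.
From mathcomp Require Import all_boot all_order all_algebra.
From mathcomp Require Import all_classical all_reals all_analysis.
From mathcomp Require Import ring lra zify.
Import Order.TTheory GRing.Theory Num.Theory.
Import numFieldNormedType.Exports.
Local Open Scope classical_set_scope.
Local Open Scope ring_scope.

(** A symmetric weight is, up to a constant, its sequence of ratios
    [a i = w (i + 1) / w i], [0 <= i]. Summing over the values on the leaves
    replaces [w i] by [(w (i - 1) + w i + w (i + 1)) ^+ d] on a tree of depth one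
    less, and this acts on the ratios by [ratio_step d]. Hence the law near the
    root is a continuous function of the iterates of the ratios, and everything
    reduces to the uniform convergence of these iterates to a limit that does
    not depend on the good weight.

    The ratios of a good weight end up in a box [a 0 <= h], [a (i + 1) <= M] with
    [M] small, on which [ratio_step d] contracts. The delicate coordinate is
    [a 0], which evolves approximately by [x |-> ((1 + x) / (1 + 2 x)) ^ d]; at its
    fixed point this map has derivative about [-0.956] when [d = 7] (and less than
    [-1] when [d = 8]), and it becomes a global contraction in the Moebius
    coordinate [1 / (5 x + 2)]. *)

(** * One step of the recursion on ratios *)

Ltac nonneg := first [ assumption | done | match goal with
  | |- is_true (_ <= _ + _) => apply: addr_ge0; nonneg
  | |- is_true (_ <= _ / _) => apply: divr_ge0; nonneg
  | |- is_true (_ <= _ * _) => apply: mulr_ge0; nonneg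
  | |- is_true (_ <= _ ^+ _) => apply: exprn_ge0; nonneg
  end | lra ].

Section Ratio.
Context {R : realType}.
Implicit Types (x s t h M : R) (a b : nat -> R).

(** For a symmetric weight with [w 0 = 1], [w 1 = x], [w 2 = x * s], this is the quotient of the
    sums of three consecutive values centred at 1 and at 0. [ratioS x s t] is the analogous quotient
    at two adjacent centres to the right, scaled so that the leftmost value is 1. *)
Definition ratio0 x s : R := (1 + x + x * s) / (1 + 2 * x).
Definition ratioS x s t : R := x * (1 + s + s * t) / (1 + x + x * s).

Lemma ratioS_ge0 x s t : 0 <= x -> 0 <= s -> 0 <= t -> 0 <= ratioS x s t.
Proof. by move=> *; rewrite /ratioS divr_ge0 // ?mulr_ge0 ?addr_ge0 ?mulr_ge0. Qed.

(** [ratioS] increases in each argument: [t] is first raised to [M], then clearing denominators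
    leaves a nonnegative combination of [h - x] and [M - s]. *)
Lemma ratioS_le x s t h M : 0 <= x <= h -> 0 <= s <= M -> 0 <= t <= M ->
  ratioS x s t <= ratioS h M M.
Proof.
move=> /andP[x0 xh] /andP[s0 sM] /andP[t0 tM].
have h0 : 0 <= h by lra.
have M0 : 0 <= M by lra.
have hM0 : 0 <= h * M by exact: mulr_ge0.
have xs0 : 0 <= x * s by exact: mulr_ge0.
have stM : s * t <= s * M by exact: ler_wpM2l.
rewrite /ratioS ler_pdivrMr; last lra.
rewrite mulrAC ler_pdivlMr; last lra.
apply: (@le_trans _ _ (x * (1 + s + s * M) * (1 + h + h * M))).
  by rewrite ler_wpM2r ?ler_wpM2l //; lra.
rewrite -subr_ge0.
have -> : h * (1 + M + M * M) * (1 + x + x * s) - x * (1 + s + s * M) * (1 + h + h * M)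
   = (h - x) * (1 + s + s * M) + h * (M - s) * (1 + M + x * M) by ring.
by nonneg.
Qed.

(** The arguments are changed one at a time. The [x] term keeps its exact denominator, which is
    converted to [coord] later; [h <= 1] serves because [x / (1 + x) ^ 2] increases on [0, 1]. *)
Lemma ratioS_diff x s t x' s' t' h M : 0 <= x -> 0 <= x' <= h -> 0 <= s <= M ->
  0 <= s' <= M -> 0 <= t <= M -> 0 <= t' <= M -> h <= 1 ->
  `|ratioS x s t - ratioS x' s' t'| <=
   (1 + M + M * M) * `|x - x'| / ((1 + x) * (1 + x')) +
   (h / (1 + h) ^+ 2 + h * M / (1 + h)) * `|s - s'| +
   h * M / (1 + h) * `|t - t'|.
Proof.
move=> x0 /andP[x'0 x'h] /andP[s0 sM] /andP[s'0 s'M] /andP[t0 tM] /andP[t'0 t'M] h1.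
have M0 : 0 <= M by lra.
have xs0 : 0 <= x * s by exact: mulr_ge0.
have x's0 : 0 <= x' * s by exact: mulr_ge0.
have x's'0 : 0 <= x' * s' by exact: mulr_ge0.
have x'h2 : x' / (1 + x') <= h / (1 + h).
  rewrite ler_pdivrMr; last lra.
  rewrite mulrAC ler_pdivlMr; last lra.
  by rewrite -subr_ge0 (_ : _ - _ = h - x'); [lra|ring].
have dx : `|ratioS x s t - ratioS x' s t| <= (1 + M + M * M) * `|x - x'| / ((1 + x) * (1 + x')).
  have -> : ratioS x s t - ratioS x' s t =
      (1 + s + s * t) * (x - x') / ((1 + x + x * s) * (1 + x' + x' * s)).
    by rewrite /ratioS; field; rewrite !gt_eqF //; lra.
  rewrite normrM normfV [`|(1 + x + _) * _|]ger0_norm ?normrM; last by nonneg.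
  rewrite [`|1 + s + _|]ger0_norm; last by nonneg.
  apply: ler_pM; rewrite ?invr_ge0; [by nonneg|by nonneg| |].
    by rewrite ler_wpM2r // lerD ?ler_pM //; lra.
  rewrite lef_pV2 ?posrE; [|by apply: mulr_gt0; lra..].
  by apply: ler_pM; lra.
have ds : `|ratioS x' s t - ratioS x' s' t| <= (h / (1 + h) ^+ 2 + h * M / (1 + h)) * `|s - s'|.
  have -> : ratioS x' s t - ratioS x' s' t =
      x' * (1 + t + x' * t) / ((1 + x' + x' * s) * (1 + x' + x' * s')) * (s - s').
    by rewrite /ratioS; field; rewrite !gt_eqF //; lra.
  rewrite normrM ger0_norm ?ler_wpM2r //; last by nonneg.
  apply: (@le_trans _ _ (x' * (1 + t + x' * t) / ((1 + x') * (1 + x')))).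
    apply: ler_wpM2l; first by nonneg.
    rewrite lef_pV2 ?posrE; [|by apply: mulr_gt0; lra..].
    by apply: ler_pM; lra.
  have -> : x' * (1 + t + x' * t) / ((1 + x') * (1 + x')) = x' / (1 + x') ^+ 2 + x' / (1 + x') * t.
    by field; rewrite !gt_eqF //; lra.
  apply: lerD.
    rewrite ler_pdivrMr ?exprn_gt0 //; last lra.
    rewrite mulrAC ler_pdivlMr ?exprn_gt0 //; last lra.
    rewrite -subr_ge0.
    have -> : h * (1 + x') ^+ 2 - x' * (1 + h) ^+ 2 = (h - x') * (1 - h * x') by ring.
    apply: mulr_ge0; first lra.
    by rewrite subr_ge0; apply: mulr_ile1; lra.
  by rewrite [leRHS]mulrAC; apply: ler_pM => //; nonneg.
have dt : `|ratioS x' s' t - ratioS x' s' t'| <= h * M / (1 + h) * `|t - t'|.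
  have -> : ratioS x' s' t - ratioS x' s' t' = x' * s' / (1 + x' + x' * s') * (t - t').
    by rewrite /ratioS; field; rewrite !gt_eqF //; lra.
  rewrite normrM ger0_norm ?ler_wpM2r //; last by nonneg.
  apply: (@le_trans _ _ (x' * s' / (1 + x'))).
    apply: ler_wpM2l; first by nonneg.
    by rewrite lef_pV2 ?posrE; lra.
  by rewrite mulrAC [leRHS]mulrAC; apply: ler_pM => //; nonneg.
have -> : ratioS x s t - ratioS x' s' t' = (ratioS x s t - ratioS x' s t) +
  (ratioS x' s t - ratioS x' s' t) + (ratioS x' s' t - ratioS x' s' t') by ring.
apply: (le_trans (ler_normD _ _)); apply: lerD => //.
by apply: (le_trans (ler_normD _ _)); apply: lerD.
Qed.

Lemma exp_diff_le (d : nat) x y g : 0 <= x <= g -> 0 <= y <= g ->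
  `|x ^+ d - y ^+ d| <= d%:R * g ^+ d.-1 * `|x - y|.
Proof.
move=> /andP[x0 xg] /andP[y0 yg]; rewrite subrXX normrM mulrC ler_wpM2r //.
rewrite ger0_norm; last by apply: sumr_ge0 => i _; rewrite mulr_ge0 ?exprn_ge0.
have -> : d%:R * g ^+ d.-1 = \sum_(i < d) g ^+ d.-1.
  by rewrite sumr_const card_ord mulr_natl.
apply: ler_sum => i _; have g0 : 0 <= g by lra.
rewrite -[in leRHS](@subnK i d.-1); last by rewrite -ltnS prednK ?(leq_ltn_trans _ (ltn_ord i)).
by rewrite exprD; apply: ler_pM; rewrite ?exprn_ge0 // lerXn2r.
Qed.

End Ratio.

(** * Contraction of the ratio at the origin *)

Section RootRatio.
Context {R : realType}.
Implicit Types (x s t h M : R) (a b : nat -> R).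

(* With the constant 2 / 5 the contraction factor of [((1 + x) / (1 + 2 x)) ^ 7]
   in this coordinate is nearly largest at the fixed point, where no choice of
   coordinate can improve it. *)
Definition coord x : R := (5 * x + 2)^-1.

(** If [t = (1 + x) / (1 + 2 * x)], then [1 / (3 - t) = 2 / 5 + coord x / 5], so the right side is a
    distance in the coordinate of the argument that produced [t]. The hypothesis compares the
    derivatives of [coord (t ^+ d)] and of [5 * r / (3 - t)]. *)
Lemma coord_exp_lip (d : nat) (r : R) :
  (forall t, 7 / 10 <= t <= 1 ->
     d%:R * t ^+ d.-1 * (3 - t) ^+ 2 <= r * (5 * t ^+ d + 2) ^+ 2) ->
  forall t u, 7 / 10 <= t <= 1 -> 7 / 10 <= u <= 1 ->
  `|coord (t ^+ d) - coord (u ^+ d)| <= 5 * r * (`|t - u| / ((3 - t) * (3 - u))).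
Proof.
move=> hr; have pos (z : R) : 7 / 10 <= z <= 1 -> 0 < 5 * z ^+ d + 2.
  move=> /andP[z0 z1].
  have : 0 <= z ^+ d by apply: exprn_ge0; lra.
  lra.
suff wl : forall t u, 7 / 10 <= t <= 1 -> 7 / 10 <= u <= 1 -> t <= u ->
    `|coord (t ^+ d) - coord (u ^+ d)| <= 5 * r * (`|t - u| / ((3 - t) * (3 - u))).
  move=> t u ht hu; have [tu|/ltW ut] := leP t u; first exact: wl.
  by rewrite distrC [`|t - u|]distrC [(3 - t) * _]mulrC; exact: wl.
move=> t u ht hu tu; move: (ht) (hu) => /andP[t0 t1] /andP[u0 u1].
(* Since [coord (z ^+ d)] decreases in [z], bounding its drop by the growth of [5 * r / (3 - z)]
   amounts to [f] being nondecreasing. *)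
pose f (z : R) : R := (5 * z ^+ d + 2)^-1 + 5 * r * (3 - z)^-1.
pose df (z : R) : R := - (5 * (d%:R * z ^+ d.-1)) / (5 * z ^+ d + 2) ^+ 2 + 5 * r / (3 - z) ^+ 2.
have fd (z : R) : 7 / 10 <= z <= 1 -> is_derive z 1 f (df z).
  move=> hz; have := pos _ hz; move: hz => /andP[z0 z1] pz.
  have n1 : 5 * z ^+ d + 2 != 0 by rewrite gt_eqF.
  have n2 : 3 - z != 0 by rewrite gt_eqF; lra.
  have e1 : is_derive z 1 (fun z : R => 5 * z ^+ d + 2) (5 * (d%:R * z ^+ d.-1)).
    have -> : (fun z : R => 5 * z ^+ d + 2) = (5 : R) *: ((@id R) ^+ d) + cst 2.
      by apply/funext => y; rewrite !fctE.
    by apply: is_derive_eq; rewrite addr0 [_ *: 1]mulr1.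
  have e2 : is_derive z 1 (fun z : R => 3 - z) (- 1).
    have -> : (fun z : R => 3 - z) = cst 3 - (@id R) by [].
    by apply: is_derive_eq; rewrite sub0r.
  have e3 := is_deriveV (f := fun z : R => 5 * z ^+ d + 2) n1 e1.
  have e4 := is_deriveV (f := fun z : R => 3 - z) n2 e2.
  have -> : f = (fun z : R => (5 * z ^+ d + 2)^-1) + (5 * r) *: (fun z : R => (3 - z)^-1) by [].
  have e5 := is_deriveD e3 (is_deriveZ (5 * r) e4).
  apply: (is_derive_eq e5).
  by rewrite /df /GRing.scale/=; field; rewrite n1 n2.
have [c ct fe] : exists2 c, c \in `[t, u]%R & f u - f t = df c * (u - t).
  apply: MVT_segment => // [z|].
    by rewrite in_itv/= => /andP[/ltW ? /ltW ?]; apply: fd; lra.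
  apply: derivable_within_continuous => z; rewrite in_itv/= => /andP[? ?].
  by apply: (@ex_derive _ _ _ _ _ _ _ (fd z _)); lra.
have {}ct : 7 / 10 <= c <= 1 by move: ct; rewrite in_itv/= => /andP[? ?]; lra.
have df0 : 0 <= df c.
  have pc := pos _ ct; have := hr _ ct; move: ct => /andP[c0 c1] hc.
  have -> : df c = 5 * r / (3 - c) ^+ 2 - 5 * (d%:R * c ^+ d.-1) / (5 * c ^+ d + 2) ^+ 2.
    by rewrite /df mulNr addrC.
  rewrite subr_ge0 ler_pdivrMr; last exact: exprn_gt0.
  rewrite mulrAC ler_pdivlMr; last by apply: exprn_gt0; lra.
  lra.
have : 0 <= f u - f t by rewrite fe mulr_ge0 // subr_ge0.
rewrite /f => h0.
have mono : coord (u ^+ d) <= coord (t ^+ d).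
  rewrite /coord lef_pV2 ?posrE ?pos //.
  have : t ^+ d <= u ^+ d by rewrite lerXn2r ?nnegrE; lra.
  lra.
rewrite ger0_norm ?subr_ge0 // distrC ger0_norm ?subr_ge0 //.
have -> : (u - t) / ((3 - t) * (3 - u)) = (3 - u)^-1 - (3 - t)^-1.
  by field; rewrite !gt_eqF //; lra.
by rewrite /coord; lra.
Qed.

(** The lower end is [(1 + h) / (1 + 2 * h)] at [h = 3 / 4]. *)
Lemma ratio0_bounds x s h : 0 <= x <= h -> 0 <= s <= 1 -> h <= 3 / 4 ->
  7 / 10 <= ratio0 x s <= 1.
Proof.
move=> /andP[x0 xh] /andP[s0 s1] hh; rewrite /ratio0.
have xs0 : 0 <= x * s by exact: mulr_ge0.
have xs1 : x * s <= x by rewrite ler_piMr.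
by rewrite ler_pdivlMr ?ler_pdivrMr; [|lra..]; apply/andP; split; lra.
Qed.

(** [x] is changed first, [s] second. For [s = 0] the change in [x] is exactly a difference of
    [coord], and a positive [s] only shrinks it. *)
Lemma ratio0_contract (d : nat) (r : R) x s x' s' h :
  (forall t, 7 / 10 <= t <= 1 ->
     d%:R * t ^+ d.-1 * (3 - t) ^+ 2 <= r * (5 * t ^+ d + 2) ^+ 2) ->
  0 <= r -> 0 <= x <= h -> 0 <= x' <= h -> 0 <= s <= 1 -> 0 <= s' <= 1 -> h <= 3 / 4 ->
  `|coord (ratio0 x s ^+ d) - coord (ratio0 x' s' ^+ d)| <=
   r * (`|coord x - coord x'| + 5 / 4 * (h / (1 + 2 * h)) * `|s - s'|).
Proof.
move=> hr r0 hx hx' hs hs' hh.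
have lip := coord_exp_lip _ _ hr.
have b1 := ratio0_bounds _ _ _ hx hs hh.
have b2 := ratio0_bounds _ _ _ hx' hs hh.
have b3 := ratio0_bounds _ _ _ hx' hs' hh.
have l1 := lip _ _ b1 b2.
have l2 := lip _ _ b2 b3.
have -> : coord (ratio0 x s ^+ d) - coord (ratio0 x' s' ^+ d) =
  (coord (ratio0 x s ^+ d) - coord (ratio0 x' s ^+ d)) +
  (coord (ratio0 x' s ^+ d) - coord (ratio0 x' s' ^+ d)) by ring.
apply: (le_trans (ler_normD _ _)); rewrite mulrDr.
move: hx hx' hs hs' => /andP[x0 xh] /andP[x'0 x'h] /andP[s0 s1] /andP[s'0 s'1].
have xs0 : 0 <= x * s by exact: mulr_ge0.
have xs1 : x * s <= x by rewrite ler_piMr.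
have x's0 : 0 <= x' * s by exact: mulr_ge0.
have x's1 : x' * s <= x' by rewrite ler_piMr.
apply: lerD.
  apply: (le_trans l1); rewrite [5 * r]mulrC -mulrA ler_wpM2l //.
  have -> : `|ratio0 x s - ratio0 x' s| / ((3 - ratio0 x s) * (3 - ratio0 x' s)) =
     (1 - s) * `|x - x'| / ((2 + 5 * x - x * s) * (2 + 5 * x' - x' * s)).
    have -> : ratio0 x s - ratio0 x' s = (1 - s) * (x' - x) / ((1 + 2 * x) * (1 + 2 * x')).
      by rewrite /ratio0; field; rewrite !gt_eqF //; lra.
    rewrite normrM normfV [`|(1 + 2 * x) * _|]ger0_norm ?mulr_ge0 //; [|lra..].
    rewrite normrM [`|1 - s|]ger0_norm; last lra.
    rewrite [`|x' - x|]distrC /ratio0; field.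
    by rewrite !gt_eqF //; lra.
  have -> : `|coord x - coord x'| = 5 * (`|x - x'| / ((2 + 5 * x) * (2 + 5 * x'))).
    have -> : coord x - coord x' = - (x - x') * (5 / ((2 + 5 * x) * (2 + 5 * x'))).
      by rewrite /coord; field; rewrite !gt_eqF //; lra.
    rewrite normrM normrN [`|5 / _|]ger0_norm; last by nonneg.
    by rewrite mulrCA.
  rewrite ler_wpM2l // [(1 - s) * _]mulrC -mulrA ler_wpM2l //.
  rewrite ler_pdivrMr; last by apply: mulr_gt0; lra.
  rewrite mulrC ler_pdivlMr; last by apply: mulr_gt0; lra.
  rewrite -subr_ge0.
  have -> : (2 + 5 * x - x * s) * (2 + 5 * x' - x' * s) - (1 - s) * ((2 + 5 * x) * (2 + 5 * x')) =
     s * (4 + 8 * x + 8 * x' + (15 + s) * (x * x')) by ring.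
  by nonneg.
apply: (le_trans l2); rewrite [5 * r]mulrC -[leLHS]mulrA ler_wpM2l //.
have -> : ratio0 x' s - ratio0 x' s' = x' / (1 + 2 * x') * (s - s').
  by rewrite /ratio0; field; rewrite !gt_eqF //; lra.
have q0 : 0 <= x' / (1 + 2 * x') by nonneg.
have q1 : x' / (1 + 2 * x') <= h / (1 + 2 * h).
  rewrite ler_pdivrMr; last lra.
  rewrite mulrAC ler_pdivlMr; last lra.
  by rewrite -subr_ge0 (_ : _ - _ = h - x'); [lra|ring].
rewrite normrM (ger0_norm q0).
(* Both ratios are at most 1, so the factors are at least 2; this turns [5 * r] into
   [r * (5 / 4)]. *)
have q2 : ((3 - ratio0 x' s) * (3 - ratio0 x' s'))^-1 <= 4^-1.
  rewrite lef_pV2 ?posrE //; last by apply: mulr_gt0; lra.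
  rewrite (_ : 4 = 2 * 2 :> R); last by ring.
  by apply: ler_pM; lra.
have q3 : x' / (1 + 2 * x') * `|s - s'| * ((3 - ratio0 x' s) * (3 - ratio0 x' s'))^-1 <=
    h / (1 + 2 * h) * `|s - s'| * 4^-1.
  apply: ler_pM => //; first by apply: mulr_ge0.
    by rewrite invr_ge0 mulr_ge0 //; lra.
  by rewrite ler_wpM2r.
lra.
Qed.
End RootRatio.

(** * Contraction on a box *)

Section Contraction.
Context {R : realType} (d : nat).
Implicit Types (x s t h M : R) (a b : nat -> R).

Definition ratio_step a : nat -> R := fun i =>
  if i is j.+1 then ratioS (a j) (a j.+1) (a j.+2) ^+ d
  else ratio0 (a 0%N) (a 1%N) ^+ d.

(** The lower bound is the least value of [ratio0 x s ^+ d] for [x] in [0, 1] and [s >= 0]. It is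
    carried along because it controls the next upper bound on [a 0]. *)
Definition box h M a : Prop :=
  (2 / 3) ^+ d <= a 0%N <= h /\ forall i, 0 <= a i.+1 <= M.

Lemma box_le h M h' M' a : h <= h' -> M <= M' -> box h M a -> box h' M' a.
Proof.
move=> hh MM [/andP[a0 ah] am]; split; first by rewrite a0 (le_trans ah).
by move=> i; have /andP[-> /le_trans->] := am i.
Qed.

(** For [s <= 1], [ratio0] decreases in [x] and increases in [s], so its maximum over the box is
    bounded by its value at [((2 / 3) ^+ d, M)]. [ratioS] is bounded by its value at [(h, M, M)],
    where [M <= h] lets [h] bound every first argument. *)
Lemma box_step h M h' M' a : 0 <= M <= h -> h <= 1 ->
  ratio0 ((2 / 3) ^+ d) M ^+ d <= h' -> ratioS h M M ^+ d <= M' ->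
  box h M a -> box h' M' (ratio_step a).
Proof.
move=> /andP[M0 Mh] h1 hh hM [/andP[a0 ah] am].
have l0 : 0 < ((2 / 3) ^+ d : R) by apply: exprn_gt0; lra.
have /andP[s0 sM] := am 0%N.
have xs0 : 0 <= a 0%N * a 1%N by apply: mulr_ge0; lra.
have xs1 : a 0%N * a 1%N <= a 0%N * M by apply: ler_wpM2l; lra.
split; last first.
  move=> i /=; have h0 : 0 <= a i <= h.
    by case: i => [|i]; [lra|have /andP[? ?] := am i; lra].
  have /andP[t0 tM] := am i; have /andP[u0 uM] := am i.+1.
  have i0 : 0 <= ratioS (a i) (a i.+1) (a i.+2) by apply: ratioS_ge0; lra.
  rewrite exprn_ge0 // (le_trans _ hM) // lerXn2r ?nnegrE //.
    by apply: ratioS_ge0; lra.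
  by apply: ratioS_le; lra.
apply/andP; split => /=.
  apply: lerXn2r; rewrite ?nnegrE; [lra|by apply: divr_ge0; lra|].
  by rewrite /ratio0 ler_pdivlMr; lra.
apply: (le_trans _ hh); apply: lerXn2r; rewrite ?nnegrE.
- by apply: divr_ge0; lra.
- by apply: divr_ge0; [nonneg|lra].
rewrite /ratio0 ler_pdivrMr; last lra.
rewrite mulrAC ler_pdivlMr; last lra.
apply: (@le_trans _ _ ((1 + a 0%N + a 0%N * M) * (1 + 2 * (2 / 3) ^+ d))).
  by apply: ler_wpM2r; lra.
rewrite -subr_ge0 (_ : _ - _ = (a 0%N - (2 / 3) ^+ d) * (1 - M)); last by ring.
by apply: mulr_ge0; lra.
Qed.

(** A weighted supremum distance: the delicate ratio [a 0] is compared through [coord], all others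
    linearly with a common weight [k]. *)
Definition close (k D : R) a b : Prop :=
  `|coord (a 0%N) - coord (b 0%N)| <= D /\ forall i, `|a i.+1 - b i.+1| <= k * D.

(* Weighted row sums of the Jacobian of [ratio_step d] in the metric [close k]. *)
Definition row0_bound (r k h : R) : R := r * (1 + 5 / 4 * (h / (1 + 2 * h)) * k).
Definition row1_bound (k h M : R) : R :=
  d%:R * ratioS h M M ^+ d.-1 *
    ((1 + M + M * M) * ((5 * h + 2) ^+ 2 / (5 * (1 + h) ^+ 2))
     + k * (h / (1 + h) ^+ 2 + 2 * (h * M / (1 + h)))).
Definition row2_bound (M : R) : R :=
  d%:R * M ^+ d.-1 *
    ((1 + M + M * M) + (M / (1 + M) ^+ 2 + 2 * (M * M / (1 + M)))).

(** Row 0 is the contraction of [ratio0]. Row 1 still sees [a 0], while all later rows involve only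
    ratios at most [M] and share one bound. *)
Lemma close_step (r k h M rho : R) a b (D : R) :
  (forall t, 7 / 10 <= t <= 1 ->
     d%:R * t ^+ d.-1 * (3 - t) ^+ 2 <= r * (5 * t ^+ d + 2) ^+ 2) ->
  0 <= r -> 0 < k -> 0 <= M <= h -> h <= 3 / 4 ->
  row0_bound r k h <= rho -> row1_bound k h M <= rho * k -> row2_bound M <= rho ->
  box h M a -> box h M b -> close k D a b ->
  close k (rho * D) (ratio_step a) (ratio_step b).
Proof.
move=> hr r0 k0 /andP[M0 Mh] hh R0 R1 R2 [/andP[a0 ah] am] [/andP[b0 bh] bm] [D0 Dk].
have l0 : 0 < ((2 / 3) ^+ d : R) by apply: exprn_gt0; lra.
have Dge : 0 <= D by apply: le_trans D0.
have kD : 0 <= k * D by apply: mulr_ge0; lra.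
have h0 : 0 <= h by lra.
split.
  apply: (@le_trans _ _ (row0_bound r k h * D)); last by rewrite ler_wpM2r.
  have /andP[s0 sM] := am 0%N; have /andP[t0 tM] := bm 0%N.
  apply: (le_trans (ratio0_contract _ _ _ _ _ _ _ hr r0 _ _ _ _ hh)); try lra.
  rewrite /row0_bound -[leRHS]mulrA ler_wpM2l //.
  rewrite (_ : _ * D = D + 5 / 4 * (h / (1 + 2 * h)) * (k * D)); last by ring.
  apply: lerD => //; apply: ler_wpM2l; last exact: Dk.
  by nonneg.
case=> [|i] /=.
  have /andP[s0 sM] := am 0%N; have /andP[t0 tM] := bm 0%N.
  have /andP[s'0 s'M] := am 1%N; have /andP[t'0 t'M] := bm 1%N.
  have g0 : 0 <= ratioS h M M by apply: ratioS_ge0; lra.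
  apply: (@le_trans _ _ (row1_bound k h M * D)); last first.
    by rewrite [leRHS]mulrCA mulrA ler_wpM2r.
  clear R0 R1 R2.
  apply: (@le_trans _ _ (d%:R * ratioS h M M ^+ d.-1 *
     `|ratioS (a 0%N) (a 1%N) (a 2%N) - ratioS (b 0%N) (b 1%N) (b 2%N)|)).
    by apply: exp_diff_le; rewrite ratioS_ge0 ?ratioS_le //; lra.
  rewrite /row1_bound -[leRHS]mulrA; apply: ler_wpM2l.
    by rewrite mulr_ge0 ?exprn_ge0.
  apply: (le_trans (@ratioS_diff _ _ _ _ _ _ _ h M _ _ _ _ _ _ _)); try lra.
  rewrite [leRHS]mulrDl -addrA; apply: lerD.
    (* The difference is expressed through [coord]; the conversion factor [(5 * z + 2) / (1 + z)]
       increases in [z], so it is taken at [h]. *)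
    have -> : (1 + M + M * M) * `|a 0%N - b 0%N| / ((1 + a 0%N) * (1 + b 0%N)) =
       (1 + M + M * M) * ((5 * a 0%N + 2) / (1 + a 0%N) * ((5 * b 0%N + 2) / (1 + b 0%N)) / 5)
        * `|coord (a 0%N) - coord (b 0%N)|.
      have -> : coord (a 0%N) - coord (b 0%N) = - (a 0%N - b 0%N) * (5 / ((5 * a 0%N + 2) * (5 * b 0%N + 2))).
        by rewrite /coord; field; rewrite !gt_eqF //; lra.
      rewrite normrM normrN [`|5 / _|]ger0_norm; last by nonneg.
      by field; rewrite !gt_eqF //; lra.
    have inc z : 0 <= z <= h -> (5 * z + 2) / (1 + z) <= (5 * h + 2) / (1 + h).
      move=> /andP[z0 zh]; rewrite ler_pdivrMr; last lra.
      by rewrite mulrAC ler_pdivlMr; lra.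
    apply: ler_pM => //; first by nonneg.
    apply: ler_wpM2l; first by nonneg.
    have -> : (5 * h + 2) ^+ 2 / (5 * (1 + h) ^+ 2) = (5 * h + 2) / (1 + h) * ((5 * h + 2) / (1 + h)) / 5.
      by field; rewrite gt_eqF //; lra.
    clear D0 hh; rewrite ler_wpM2r ?invr_ge0 //; apply: ler_pM; [nonneg|nonneg|apply: inc; lra|apply: inc; lra].
  have -> : k * (h / (1 + h) ^+ 2 + 2 * (h * M / (1 + h))) * D =
    (h / (1 + h) ^+ 2 + h * M / (1 + h)) * (k * D) + h * M / (1 + h) * (k * D) by ring.
  by apply: lerD; apply: ler_wpM2l => //; nonneg.
have /andP[s0 sM] := am i; have /andP[t0 tM] := bm i.
have /andP[s'0 s'M] := am i.+1; have /andP[t'0 t'M] := bm i.+1.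
have /andP[s''0 s''M] := am i.+2; have /andP[t''0 t''M] := bm i.+2.
apply: (@le_trans _ _ (row2_bound M * (k * D))); last first.
  by rewrite [leRHS]mulrCA ler_wpM2r.
clear R0 R1 R2 D0.
have gM : ratioS M M M = M.
  have M20 : 0 <= M * M by exact: mulr_ge0.
  by rewrite /ratioS mulfK // gt_eqF //; lra.
apply: (@le_trans _ _ (d%:R * M ^+ d.-1 *
   `|ratioS (a i.+1) (a i.+2) (a i.+3) - ratioS (b i.+1) (b i.+2) (b i.+3)|)).
  by rewrite -[X in _ * X ^+ _ * _]gM; apply: exp_diff_le; rewrite ratioS_ge0 ?ratioS_le //; lra.
rewrite /row2_bound -[leRHS]mulrA; apply: ler_wpM2l.
  by rewrite mulr_ge0 ?exprn_ge0.
apply: (le_trans (@ratioS_diff _ _ _ _ _ _ _ M M _ _ _ _ _ _ _)); try lra.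
rewrite [leRHS]mulrDl -addrA; apply: lerD.
  rewrite -mulrA; apply: ler_wpM2l; first by nonneg.
  rewrite ler_pdivrMr; last by apply: mulr_gt0; lra.
  apply: (le_trans (Dk i)); rewrite ler_peMr // -[leLHS]mulr1.
  by apply: ler_pM; lra.
have -> : (M / (1 + M) ^+ 2 + 2 * (M * M / (1 + M))) * (k * D) =
  (M / (1 + M) ^+ 2 + M * M / (1 + M)) * (k * D) + M * M / (1 + M) * (k * D) by ring.
by apply: lerD; apply: ler_wpM2l => //; nonneg.
Qed.

End Contraction.

(** * Entering the box *)

Section BurnIn.
Context {R : realType}.
Implicit Types (x s t h M : R) (a b : nat -> R).

Definition good_ratio (k : nat) (c : R) a : Prop :=
  (forall i, (i < k)%N -> a i = 1) /\ (forall i, (k <= i)%N -> 0 <= a i <= c).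

Section Burn.
Variable d : nat.
Hypothesis d2 : (2 <= d)%N.
Let F : (nat -> R) -> nat -> R := ratio_step d.

(** One step shortens the plateau by one. At its edge the quotient is at most [(1 + 1 + c) / 3],
    further out it is no larger, and the power [d] only decreases it. *)
Lemma good_ratio_step (k : nat) (c : R) a : 0 <= c < 1 -> good_ratio k.+1 c a ->
  good_ratio k ((2 + c) / 3) (F a).
Proof.
move=> /andP[c0 c1] [a1 ac].
have a01 i : 0 <= a i <= 1.
  by have [ik|ki] := ltnP i k.+1; [rewrite a1 //; lra|have := ac _ ki; lra].
have d0 : (0 < d)%N by exact: leq_trans d2.
have pw x : 0 <= x <= (2 + c) / 3 -> 0 <= x ^+ d <= (2 + c) / 3.
  move=> /andP[x0 xc]; rewrite exprn_ge0 //= (le_trans _ xc) //.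
  by rewrite ler_iXnr //; lra.
split=> [[|i] ik|[|i] ki] /=.
- by rewrite !a1 // /ratio0 (_ : _ / _ = 1) ?expr1n //; field.
- have e0 : a i = 1 by apply: a1; do 2 apply: ltnW.
  have e1 : a i.+1 = 1 by apply: a1; apply: ltnW.
  rewrite e0 e1 (a1 i.+2) //.
  by rewrite /ratioS (_ : _ / _ = 1) ?expr1n //; field.
- apply: pw; move: ki; rewrite leqn0 => /eqP k0; rewrite k0 in a1 ac.
  have := ac 1%N isT; rewrite /ratio0 (a1 0%N) //.
  by rewrite (_ : _ / _ = (2 + a 1%N) / 3); [lra|field].
- have t1 := ac i.+2 ki; have /andP[x0 x1] := a01 i; have /andP[s0 s1] := a01 i.+1.
  apply: pw; rewrite ratioS_ge0 //=; last lra.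
  have xs : 0 <= a i * a i.+1 by exact: mulr_ge0.
  rewrite /ratioS ler_pdivrMr; last lra.
  have st : a i.+1 * a i.+2 <= a i.+1 * c by apply: ler_wpM2l => //; lra.
  apply: (@le_trans _ _ (a i * (1 + a i.+1 + a i.+1 * c))).
    by apply: ler_wpM2l => //; lra.
  rewrite -subr_ge0 (_ : _ - _ = ((1 - a i) * (2 + c) + a i * (1 + 2 * c) * (1 - a i.+1)) / 3); last by field.
  by nonneg.
Qed.

Lemma box_good_ratio_step (c : R) a : 0 <= c <= 1 -> good_ratio 0 c a -> box d 1 c (F a).
Proof.
move=> /andP[c0 c1] [_ ac]; have d0 : (0 < d)%N by exact: leq_trans d2.
split=> [|i] /=.
  have a0 := ac 0%N isT; have a1 := ac 1%N isT.
  have xs : 0 <= a 0%N * a 1%N by apply: mulr_ge0; lra.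
  have xs1 : a 0%N * a 1%N <= a 0%N * 1 by apply: ler_wpM2l; lra.
  have r0 : 2 / 3 <= ratio0 (a 0%N) (a 1%N) by rewrite /ratio0 ler_pdivlMr; lra.
  apply/andP; split; first by apply: lerXn2r; rewrite ?nnegrE; lra.
  by apply: exprn_ile1; [lra|rewrite /ratio0 ler_pdivrMr; lra].
have x := ac i isT; have s := ac i.+1 isT; have t := ac i.+2 isT.
have g0 : 0 <= ratioS (a i) (a i.+1) (a i.+2) by apply: ratioS_ge0; lra.
rewrite exprn_ge0 //=; apply: (@le_trans _ _ (c ^+ d)); last by rewrite ler_iXnr.
have cc : 0 <= c * c by exact: mulr_ge0.
rewrite lerXn2r ?nnegrE //; apply: (le_trans (ratioS_le _ _ _ _ _ x s t)).
by rewrite /ratioS mulfK // gt_eqF //; lra.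
Qed.

Lemma good_ratio_box (k : nat) (c : R) a : 0 <= c < 1 -> good_ratio k c a ->
  exists n c', 0 <= c' < 1 /\ box d 1 c' (iter n F a).
Proof.
elim: k c a => [|k IH] c a c01 ga.
  by exists 1%N, c; split=> //; apply: box_good_ratio_step => //; lra.
have c01' : 0 <= (2 + c) / 3 < 1 by lra.
have [n [c' [c'01 bx]]] := IH _ _ c01' (good_ratio_step _ _ _ c01 ga).
by exists n.+1, c'; rewrite iterSr.
Qed.

Lemma bernoulli_ge x (n : nat) : 0 <= x -> 1 + n%:R * x <= (1 + x) ^+ n.
Proof.
move=> x0; elim: n => [|n IH]; first by rewrite mul0r addr0 expr0.
rewrite exprSr; apply: (@le_trans _ _ ((1 + n%:R * x) * (1 + x))).
  rewrite -natr1 -subr_ge0 (_ : _ - _ = n%:R * (x * x)); last by ring.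
  by rewrite !mulr_ge0.
by apply: ler_wpM2r => //; lra.
Qed.

(* The distance from [M] to 1 grows by the factor 51 / 50, until [M <= 1 / 2];
   the factor is the largest one for which [M = 1 / 2] is mapped to [49 / 100]. *)
Lemma box_half_step M a : 1 / 2 <= M < 1 -> box d 1 M a ->
  box d 1 (1 - 51 / 50 * (1 - M)) (F a).
Proof.
move=> /andP[M0 M1]; have l0 : 0 < ((2 / 3) ^+ d : R) by apply: exprn_gt0; lra.
have lM : 0 <= (2 / 3) ^+ d * M by apply: mulr_ge0; lra.
have lM1 : (2 / 3) ^+ d * M <= (2 / 3) ^+ d * 1 by apply: ler_wpM2l; lra.
apply: box_step; [lra|lra| |].
  apply: exprn_ile1; first by apply: divr_ge0; lra.
  by rewrite ler_pdivrMr; lra.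
have MM : 0 <= M * M by apply: mulr_ge0; lra.
have MM1 : M * M <= 1 * 1 by apply: ler_pM; lra.
have g0 : 0 <= ratioS 1 M M by apply: ratioS_ge0; lra.
(* The base is at most 1, so [d = 2] is the worst case. *)
apply: (@le_trans _ _ (ratioS 1 M M ^+ 2)).
  by apply: ler_wiXn2l => //; rewrite /ratioS ler_pdivrMr; lra.
rewrite /ratioS expr_div_n ler_pdivrMr; last by apply: exprn_gt0; lra.
rewrite -subr_ge0 (_ : _ - _ =
   (1 - M) * (M - 1 / 2) * ((1 - M) ^+ 2 - 112 / 25 * (1 - M) + 141 / 25)); last by field.
have m2 : 0 <= (1 - M) ^+ 2 by apply: exprn_ge0; lra.
by apply: mulr_ge0; [apply: mulr_ge0; lra | lra].
Qed.

Lemma box_half M a : 0 <= M < 1 -> box d 1 M a -> exists n, box d 1 (1 / 2) (iter n F a).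
Proof.
move=> /andP[M0 M1] bx.
have key n : box d 1 (Num.max (1 / 2) (1 - (1 + 1 / 50) ^+ n * (1 - M))) (iter n F a).
  elim: n => [|n IH].
    by apply: box_le bx => //; rewrite expr0 le_max; apply/orP; right; lra.
  set m := Num.max _ _ in IH.
  have m1 : 1 / 2 <= m by rewrite le_max lexx.
  have p1 : 1 <= (1 + 1 / 50 : R) ^+ n by apply: exprn_ege1; lra.
  have p2 : 0 < (1 + 1 / 50 : R) ^+ n * (1 - M) by apply: mulr_gt0; lra.
  have m2 : m < 1 by rewrite gt_max; apply/andP; split; lra.
  apply: box_le (box_half_step _ _ _ IH) => //; last by rewrite m1.
  rewrite exprSr le_max; apply/orP; rewrite /m.
  by case: (leP (1 / 2) (1 - (1 + 1 / 50) ^+ n * (1 - M))) => ?; [right|left]; lra.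
(* By Bernoulli, [(1 + 1 / 50) ^ n * (1 - M) >= 1 / 2] as soon as [n * (1 - M) >= 25]. *)
have [n hn] : exists n : nat, 25 / (1 - M) <= n%:R.
  exists (Num.bound (25 / (1 - M))); apply/ltW/archi_boundP.
  by apply: divr_ge0; lra.
exists n; apply: box_le (key n) => //; rewrite ge_max lexx /=.
move: hn; rewrite ler_pdivrMr; last lra.
have b1 : 1 + n%:R * (1 / 50) <= (1 + 1 / 50 : R) ^+ n by apply: bernoulli_ge; lra.
have : (1 + n%:R * (1 / 50)) * (1 - M) <= (1 + 1 / 50) ^+ n * (1 - M).
  by apply: ler_wpM2r => //; lra.
lra.
Qed.

(** [box_step] with denominators cleared, so that for numerical data both conditions are
    inequalities between explicit rational numbers. *)
Lemma box_chain h M h' M' a n : 0 <= M <= h -> h <= 1 ->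
  (1 + (2 / 3) ^+ d + (2 / 3) ^+ d * M) ^+ d <= h' * (1 + 2 * (2 / 3) ^+ d) ^+ d ->
  (h * (1 + M + M * M)) ^+ d <= M' * (1 + h + h * M) ^+ d ->
  box d h M (iter n F a) -> box d h' M' (iter n.+1 F a).
Proof.
move=> Mh h1 e1 e2; have l0 : 0 < ((2 / 3) ^+ d : R) by apply: exprn_gt0; lra.
have hM : 0 <= h * M by apply: mulr_ge0; lra.
apply: box_step => //; first by rewrite expr_div_n ler_pdivrMr // exprn_gt0 //; lra.
by rewrite expr_div_n ler_pdivrMr // exprn_gt0 //; lra.
Qed.

Lemma good_ratio_box_half (k : nat) (c : R) a : 0 <= c < 1 -> good_ratio k c a ->
  exists n, box d 1 (1 / 2) (iter n F a).
Proof.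
move=> c01 ga; have [n [c' [c'01 bx]]] := good_ratio_box _ _ _ c01 ga.
by have [m bm] := box_half _ _ c'01 bx; exists (m + n)%N; rewrite iterD.
Qed.

End Burn.
End BurnIn.

(** * The cases [d = 2], ..., [d = 7] *)

(* On [a, b] every polynomial of degree <= n with nonnegative Bernstein
   coefficients is a nonnegative combination of the (t - a)^i (b - t)^(n-i). *)
Ltac bernstein_terms Ha Hb i j :=
  generalize (mulr_ge0 (exprn_ge0 i Ha) (exprn_ge0 j Hb));
  lazymatch j with 0%N => idtac | S ?j' => bernstein_terms Ha Hb (S i) j' end.
Ltac bernstein a b t n :=
  let Ha := fresh "Ha" in let Hb := fresh "Hb" in
  (have Ha : 0 <= t - a by lra);
  (have Hb : 0 <= b - t by lra);
  let n' := eval compute in n in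
  bernstein_terms Ha Hb 0%N n'; clear; intros; lra.

Section Numerics.
Context {R : realType}.
Implicit Types (x s t h M : R) (a b : nat -> R).
(* Square roots are avoided: [s], [e] and [q] bound the square roots of [d],
   [t ^ (d - 1)] and of the contraction factor. *)
Lemma exp_sq_bound (d : nat) (s q e t : R) :
  d%:R <= s ^+ 2 -> t ^+ d.-1 <= e ^+ 2 -> 0 <= s -> 0 <= e -> 0 <= t <= 1 ->
  s * e * (3 - t) <= q * (5 * t ^+ d + 2) ->
  d%:R * t ^+ d.-1 * (3 - t) ^+ 2 <= q ^+ 2 * (5 * t ^+ d + 2) ^+ 2.
Proof.
move=> ds te s0 e0 /andP[t0 t1] le1; rewrite -[leRHS]exprMn.
apply: (@le_trans _ _ ((s * e * (3 - t)) ^+ 2)); last first.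
  have se0 : 0 <= s * e * (3 - t) by apply: mulr_ge0; [nonneg|lra].
  by rewrite lerXn2r ?nnegrE // (le_trans se0).
rewrite !exprMn ler_wpM2r ?exprn_ge0 //; first lra.
by apply: ler_pM => //; nonneg.
Qed.

(** All that the limit needs to know about [d]: a box that is reached, invariant and contracted. The
    rate [199 / 200] is common to [2 <= d <= 7]. *)
Definition contracts (d : nat) h M (k : R) : Prop :=
  [/\ 0 < k, 0 <= M <= 1 / 2 /\ h <= 1,
      forall a, box d 1 (1 / 2) a -> exists n, box d h M (iter n (ratio_step d) a),
      forall a, box d h M a -> box d h M (ratio_step d a) &
      forall a b D, box d h M a -> box d h M b -> close k D a b ->
        close k (199 / 200 * D) (ratio_step d a) (ratio_step d b)].

(** Invariance is [box_chain] from the box to itself; contraction is [close_step] with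
    [r = q ^+ 2]. *)
Lemma contractsI (d : nat) h M (k q : R) :
  0 < k -> 0 <= M <= 1 / 2 -> M <= h -> h <= 3 / 4 ->
  (1 + (2 / 3) ^+ d + (2 / 3) ^+ d * M) ^+ d <= h * (1 + 2 * (2 / 3) ^+ d) ^+ d ->
  (h * (1 + M + M * M)) ^+ d <= M * (1 + h + h * M) ^+ d ->
  (forall t, 7 / 10 <= t <= 1 ->
     d%:R * t ^+ d.-1 * (3 - t) ^+ 2 <= q ^+ 2 * (5 * t ^+ d + 2) ^+ 2) ->
  row0_bound (q ^+ 2) k h <= 199 / 200 ->
  row1_bound d k h M <= 199 / 200 * k ->
  row2_bound d M <= 199 / 200 ->
  (forall a, box d 1 (1 / 2) a -> exists n, box d h M (iter n (ratio_step d) a)) ->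
  contracts d h M k.
Proof.
move=> k0 Mh2 Mh hh e1 e2 hr R0 R1 R2 bi; split => //; first by split=> //; lra.
  by move=> a; apply: (@box_chain _ d h M h M a 0%N) => //; lra.
by move=> a b D; apply: (close_step d (q ^+ 2)) => //; [exact: sqr_ge0|lra].
Qed.

(* The constants were found numerically: [h] and [M] by iterating [box_chain] from
   [h = 1], [M = 1 / 2], then [k] by balancing the row sums. *)
Lemma contracts2 : contracts 2 (27 / 40) (23 / 100) (17 / 4).
Proof.
apply: (@contractsI _ _ _ _ (624 / 1000)); [lra|lra|lra|lra|lra|lra| | | | |].
(* [1415 / 1000] exceeds the square root of 2, and [(1 + t) / 2] that of [t] by the
   arithmetic-geometric mean inequality. The same device serves every even [d]; for odd [d] the root
   of [t ^+ d.-1] is a power of [t]. *)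
- move=> t /andP[t0 t1]; apply: (@exp_sq_bound _ (1415 / 1000) _ ((1 + t) / 2)); [lra| |lra|nonneg|lra|].
    rewrite -subr_ge0 (_ : _ - _ = ((t - 1) / 2) ^+ 2); [|by field].
    by apply: sqr_ge0.
  by bernstein (7 / 10 : R) (1 : R) t 2%N.
- have e3 : (1 + 2 * (27 / 40))^-1 = 20 / 47 :> R by field.
  by rewrite /row0_bound e3; lra.
- have e1 : (1 + 27 / 40)^-1 = 40 / 67 :> R by field.
  have e2 : (1 + 27 / 40 + 27 / 40 * (23 / 100))^-1 = 4000 / 7321 :> R by field.
  by rewrite /row1_bound /ratioS invfM -!exprVn e1 e2 /=; lra.
- have e4 : (1 + 23 / 100)^-1 = 100 / 123 :> R by field.
  by rewrite /row2_bound -!exprVn e4 /=; lra.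
- move=> a b0.
  have b1 : box 2 (779 / 1000) (491 / 1000) (iter 1 (ratio_step 2) a).
    by apply: (@box_chain _ 2 1 (1 / 2) _ _ a 0) b0; lra.
  have b2 : box 2 (31 / 40) (39 / 100) (iter 2 (ratio_step 2) a).
    by apply: (@box_chain _ 2 (779 / 1000) (491 / 1000) _ _ a 1) b1; lra.
  have b3 : box 2 (367 / 500) (83 / 250) (iter 3 (ratio_step 2) a).
    by apply: (@box_chain _ 2 (31 / 40) (39 / 100) _ _ a 2) b2; lra.
  have b4 : box 2 (711 / 1000) (287 / 1000) (iter 4 (ratio_step 2) a).
    by apply: (@box_chain _ 2 (367 / 500) (83 / 250) _ _ a 3) b3; lra.
  have b5 : box 2 (693 / 1000) (259 / 1000) (iter 5 (ratio_step 2) a).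
    by apply: (@box_chain _ 2 (711 / 1000) (287 / 1000) _ _ a 4) b4; lra.
  have b6 : box 2 (341 / 500) (241 / 1000) (iter 6 (ratio_step 2) a).
    by apply: (@box_chain _ 2 (693 / 1000) (259 / 1000) _ _ a 5) b5; lra.
  have b7 : box 2 (27 / 40) (231 / 1000) (iter 7 (ratio_step 2) a).
    by apply: (@box_chain _ 2 (341 / 500) (241 / 1000) _ _ a 6) b6; lra.
  have b8 : box 2 (27 / 40) (23 / 100) (iter 8 (ratio_step 2) a).
    by apply: (@box_chain _ 2 (27 / 40) (231 / 1000) _ _ a 7) b7; lra.
  by exists 8%N.
Qed.

Lemma contracts3 : contracts 3 (61 / 100) (1 / 10) (3 / 2).
Proof.
apply: (@contractsI _ _ _ _ (755 / 1000)); [lra|lra|lra|lra|lra|lra| | | | |].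
- move=> t /andP[t0 t1]; apply: (@exp_sq_bound _ (1733 / 1000) _ (t)); [lra| |lra|nonneg|lra|].
    by [].
  by bernstein (7 / 10 : R) (1 : R) t 3%N.
- have e3 : (1 + 2 * (61 / 100))^-1 = 50 / 111 :> R by field.
  by rewrite /row0_bound e3; lra.
- have e1 : (1 + 61 / 100)^-1 = 100 / 161 :> R by field.
  have e2 : (1 + 61 / 100 + 61 / 100 * (1 / 10))^-1 = 1000 / 1671 :> R by field.
  by rewrite /row1_bound /ratioS invfM -!exprVn e1 e2 /=; lra.
- have e4 : (1 + 1 / 10)^-1 = 10 / 11 :> R by field.
  by rewrite /row2_bound -!exprVn e4 /=; lra.
- move=> a b0.
  have b1 : box 3 (747 / 1000) (43 / 125) (iter 1 (ratio_step 3) a).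
    by apply: (@box_chain _ 3 1 (1 / 2) _ _ a 0) b0; lra.
  have b2 : box 3 (677 / 1000) (81 / 500) (iter 2 (ratio_step 3) a).
    by apply: (@box_chain _ 3 (747 / 1000) (43 / 125) _ _ a 1) b1; lra.
  have b3 : box 3 (61 / 100) (1 / 10) (iter 3 (ratio_step 3) a).
    by apply: (@box_chain _ 3 (677 / 1000) (81 / 500) _ _ a 2) b2; lra.
  by exists 3%N.
Qed.

Lemma contracts4 : contracts 4 (16 / 25) (7 / 100) (7 / 10).
Proof.
apply: (@contractsI _ _ _ _ (86 / 100)); [lra|lra|lra|lra|lra|lra| | | | |].
- move=> t /andP[t0 t1]; apply: (@exp_sq_bound _ (2) _ (t * (1 + t) / 2)); [lra| |lra|nonneg|lra|].
    rewrite -subr_ge0 (_ : _ - _ = ((t - 1) / 2) ^+ 2 * t ^+ 2); [|by field].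
    by apply: mulr_ge0; [exact: sqr_ge0|nonneg].
  by bernstein (7 / 10 : R) (1 : R) t 4%N.
- have e3 : (1 + 2 * (16 / 25))^-1 = 25 / 57 :> R by field.
  by rewrite /row0_bound e3; lra.
- have e1 : (1 + 16 / 25)^-1 = 25 / 41 :> R by field.
  have e2 : (1 + 16 / 25 + 16 / 25 * (7 / 100))^-1 = 625 / 1053 :> R by field.
  by rewrite /row1_bound /ratioS invfM -!exprVn e1 e2 /=; lra.
- have e4 : (1 + 7 / 100)^-1 = 100 / 107 :> R by field.
  by rewrite /row2_bound -!exprVn e4 /=; lra.
- move=> a b0.
  have b1 : box 4 (373 / 500) (241 / 1000) (iter 1 (ratio_step 4) a).
    by apply: (@box_chain _ 4 1 (1 / 2) _ _ a 0) b0; lra.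
  have b2 : box 4 (16 / 25) (7 / 100) (iter 2 (ratio_step 4) a).
    by apply: (@box_chain _ 4 (373 / 500) (241 / 1000) _ _ a 1) b1; lra.
  by exists 2%N.
Qed.

Lemma contracts5 : contracts 5 (16 / 25) (3 / 100) (3 / 10).
Proof.
apply: (@contractsI _ _ _ _ (92 / 100)); [lra|lra|lra|lra|lra|lra| | | | |].
- move=> t /andP[t0 t1]; apply: (@exp_sq_bound _ (2237 / 1000) _ (t ^+ 2)); [lra| |lra|nonneg|lra|].
    by rewrite -!exprM.
  by bernstein (7 / 10 : R) (1 : R) t 5%N.
- have e3 : (1 + 2 * (16 / 25))^-1 = 25 / 57 :> R by field.
  by rewrite /row0_bound e3; lra.
- have e1 : (1 + 16 / 25)^-1 = 25 / 41 :> R by field.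
  have e2 : (1 + 16 / 25 + 16 / 25 * (3 / 100))^-1 = 625 / 1037 :> R by field.
  by rewrite /row1_bound /ratioS invfM -!exprVn e1 e2 /=; lra.
- have e4 : (1 + 3 / 100)^-1 = 100 / 103 :> R by field.
  by rewrite /row2_bound -!exprVn e4 /=; lra.
- move=> a b0.
  have b1 : box 5 (383 / 500) (169 / 1000) (iter 1 (ratio_step 5) a).
    by apply: (@box_chain _ 5 1 (1 / 2) _ _ a 0) b0; lra.
  have b2 : box 5 (16 / 25) (3 / 100) (iter 2 (ratio_step 5) a).
    by apply: (@box_chain _ 5 (383 / 500) (169 / 1000) _ _ a 1) b1; lra.
  by exists 2%N.
Qed.

Lemma contracts6 : contracts 6 (16 / 25) (1 / 100) (12 / 100).
Proof.
apply: (@contractsI _ _ _ _ (95 / 100)); [lra|lra|lra|lra|lra|lra| | | | |].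
- move=> t /andP[t0 t1]; apply: (@exp_sq_bound _ (2450 / 1000) _ (t ^+ 2 * (1 + t) / 2)); [lra| |lra|nonneg|lra|].
    rewrite -subr_ge0 (_ : _ - _ = ((t - 1) / 2) ^+ 2 * t ^+ 4); [|by field].
    by apply: mulr_ge0; [exact: sqr_ge0|nonneg].
  have [tb0|/ltW tb0] := leP t (4 / 5).
    by bernstein (7 / 10 : R) (4 / 5 : R) t 6%N.
  by bernstein (4 / 5 : R) (1 : R) t 6%N.
- have e3 : (1 + 2 * (16 / 25))^-1 = 25 / 57 :> R by field.
  by rewrite /row0_bound e3; lra.
- have e1 : (1 + 16 / 25)^-1 = 25 / 41 :> R by field.
  have e2 : (1 + 16 / 25 + 16 / 25 * (1 / 100))^-1 = 625 / 1029 :> R by field.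
  by rewrite /row1_bound /ratioS invfM -!exprVn e1 e2 /=; lra.
- have e4 : (1 + 1 / 100)^-1 = 100 / 101 :> R by field.
  by rewrite /row2_bound -!exprVn e4 /=; lra.
- move=> a b0.
  have b1 : box 6 (199 / 250) (59 / 500) (iter 1 (ratio_step 6) a).
    by apply: (@box_chain _ 6 1 (1 / 2) _ _ a 0) b0; lra.
  have b2 : box 6 (133 / 200) (3 / 250) (iter 2 (ratio_step 6) a).
    by apply: (@box_chain _ 6 (199 / 250) (59 / 500) _ _ a 1) b1; lra.
  have b3 : box 6 (16 / 25) (1 / 100) (iter 3 (ratio_step 6) a).
    by apply: (@box_chain _ 6 (133 / 200) (3 / 250) _ _ a 2) b2; lra.
  by exists 3%N.
Qed.

Lemma contracts7 : contracts 7 (7 / 10) (1 / 100) (77 / 1000).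
Proof.
apply: (@contractsI _ _ _ _ (982 / 1000)); [lra|lra|lra|lra|lra|lra| | | | |].
- move=> t /andP[t0 t1]; apply: (@exp_sq_bound _ (2646 / 1000) _ (t ^+ 3)); [lra| |lra|nonneg|lra|].
    by rewrite -!exprM.
  (* The slack falls below [1 / 100] near [t = 41 / 50]; subdivision brings the Bernstein
     coefficients closer to the values of the polynomial. *)
  have [tb0|/ltW tb0] := leP t (4 / 5).
    by bernstein (7 / 10 : R) (4 / 5 : R) t 7%N.
  have [tb1|/ltW tb1] := leP t (17 / 20).
    by bernstein (4 / 5 : R) (17 / 20 : R) t 7%N.
  by bernstein (17 / 20 : R) (1 : R) t 7%N.
- have e3 : (1 + 2 * (7 / 10))^-1 = 5 / 12 :> R by field.
  by rewrite /row0_bound e3; lra.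
- have e1 : (1 + 7 / 10)^-1 = 10 / 17 :> R by field.
  have e2 : (1 + 7 / 10 + 7 / 10 * (1 / 100))^-1 = 1000 / 1707 :> R by field.
  by rewrite /row1_bound /ratioS invfM -!exprVn e1 e2 /=; lra.
- have e4 : (1 + 1 / 100)^-1 = 100 / 101 :> R by field.
  by rewrite /row2_bound -!exprVn e4 /=; lra.
- move=> a b0.
  have b1 : box 7 (831 / 1000) (83 / 1000) (iter 1 (ratio_step 7) a).
    by apply: (@box_chain _ 7 1 (1 / 2) _ _ a 0) b0; lra.
  have b2 : box 7 (709 / 1000) (3 / 500) (iter 2 (ratio_step 7) a).
    by apply: (@box_chain _ 7 (831 / 1000) (83 / 1000) _ _ a 1) b1; lra.
  have b3 : box 7 (7 / 10) (1 / 100) (iter 3 (ratio_step 7) a).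
    by apply: (@box_chain _ 7 (709 / 1000) (3 / 500) _ _ a 2) b2; lra.
  by exists 3%N.
Qed.

Lemma contracts_exist (d : nat) : (2 <= d <= 7)%N -> exists h M k, contracts d h M k.
Proof.
move: d => [|[|[|[|[|[|[|[|d]]]]]]]] // _.
- by do 3 eexists; exact: contracts2.
- by do 3 eexists; exact: contracts3.
- by do 3 eexists; exact: contracts4.
- by do 3 eexists; exact: contracts5.
- by do 3 eexists; exact: contracts6.
- by do 3 eexists; exact: contracts7.
Qed.
End Numerics.

(** * The limiting ratios *)

Section Limit.
Context {R : realType}.
Implicit Types (x s t h M : R) (a b : nat -> R).

(** Two points of the box are at distance at most [1 + k^-1] in [close k], and each step gains
    [199 / 200]. The factor [10 + k] returns to plain differences: undoing [coord] costs at most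
    [49 / 5], the other ratios cost [k]. *)
Lemma box_iter_close (d : nat) h M (k : R) a b n : contracts d h M k ->
  box d h M a -> box d h M b ->
  forall i, `|iter n (ratio_step d) a i - iter n (ratio_step d) b i|
     <= (10 + k) * (1 + k^-1) * (199 / 200) ^+ n.
Proof.
move=> [k0 [/andP[M0 M1] h1] _ inv ctr] ba bb.
have ibox a' m : box d h M a' -> box d h M (iter m (ratio_step d) a').
  by move=> b0; elim: m => [//|m IH]; exact: inv.
have l0 : 0 < ((2 / 3) ^+ d : R) by apply: exprn_gt0; lra.
have kV : 0 < k^-1 by rewrite invr_gt0.
have D0 : close k (1 + k^-1) a b.
  move: ba bb => [/andP[a0 ah] am] [/andP[b0 bh] bm]; split.
    have c01 (z : R) : 0 < z -> 0 <= coord z <= 1 / 2.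
      move=> z0; rewrite /coord invr_ge0 -[1 / 2]mul1r -[(5 * z + 2)^-1]mul1r; apply/andP; split; first lra.
      by rewrite mul1r mul1r div1r lef_pV2 ?posrE; lra.
    have := c01 _ (lt_le_trans l0 a0); have := c01 _ (lt_le_trans l0 b0).
    by move=> /andP[? ?] /andP[? ?]; rewrite ler_norml; apply/andP; split; lra.
  move=> i; rewrite mulrDr mulr1 mulfV ?gt_eqF //.
  have /andP[? ?] := am i; have /andP[? ?] := bm i.
  by rewrite ler_norml; apply/andP; split; lra.
have {D0} : close k ((199 / 200) ^+ n * (1 + k^-1)) (iter n (ratio_step d) a) (iter n (ratio_step d) b).
  elim: n => [|n IH]; first by rewrite expr0 mul1r.
  by rewrite exprS -mulrA; apply: ctr => //; exact: ibox.
set D := _ * (1 + _); have D0 : 0 <= D by apply: mulr_ge0; [apply: exprn_ge0|]; lra.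
move: (ibox _ n ba) (ibox _ n bb) => {ba bb}.
set x := iter n _ a; set y := iter n _ b.
move=> [/andP[x0 xh] _] [/andP[y0 yh] _] [c0 c1].
rewrite -mulrA [(1 + _) * _]mulrC -/D => -[|i]; last first.
  by apply: (le_trans (c1 i)); apply: ler_wpM2r => //; lra.
have -> : x 0%N - y 0%N = - ((5 * x 0%N + 2) * (5 * y 0%N + 2) / 5) * (coord (x 0%N) - coord (y 0%N)).
  by rewrite /coord; field; rewrite !gt_eqF //; lra.
rewrite normrM normrN [`|_ / 5|]ger0_norm; last by apply: divr_ge0; [apply: mulr_ge0; lra|].
apply: ler_pM => //; first by apply: divr_ge0; [apply: mulr_ge0; lra|].
have : (5 * x 0%N + 2) * (5 * y 0%N + 2) <= 7 * 7 by apply: ler_pM; lra.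
by lra.
Qed.

Lemma geometric_small (C e : R) : 0 < e -> \forall n \near \oo, C * (199 / 200) ^+ n <= e.
Proof.
move=> e0; have : (fun n => C * (199 / 200) ^+ n) @ \oo --> 0.
  by apply: (@cvg_geometric R C (199 / 200)); rewrite ger0_norm; lra.
by move=> /cvgr_le; apply.
Qed.

Lemma cvg_exprn (f : nat -> R) (l : R) d : f @ \oo --> l -> (fun n => f n ^+ d) @ \oo --> l ^+ d.
Proof.
by move=> fl; exact: (@continuous_cvg _ _ _ _ _ f (fun x : R => x ^+ d) l (@exprn_continuous R d l) fl).
Qed.

Lemma cvg_ratio_step (d : nat) (u : nat -> nat -> R) b :
  (forall i, 0 <= b i) -> (forall i, u ^~ i @ \oo --> b i) ->
  forall i, (fun n => ratio_step d (u n) i) @ \oo --> ratio_step d b i.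
Proof.
move=> b0 ub.
case=> [|i] /=; apply: cvg_exprn.
  apply: cvgM.
    apply: cvgD; last exact: cvgM.
    by apply: cvgD => //; exact: cvg_cst.
  apply: cvgV; first by have b00 := b0 0%N; rewrite gt_eqF //; lra.
  apply: cvgD; first exact: cvg_cst.
  by apply: cvgM => //; exact: cvg_cst.
apply: cvgM.
  apply: cvgM => //; apply: cvgD; last exact: cvgM.
  by apply: cvgD => //; exact: cvg_cst.
apply: cvgV.
  by rewrite gt_eqF //; have p := mulr_ge0 (b0 i) (b0 i.+1); have := b0 i; lra.
apply: cvgD; last exact: cvgM.
by apply: cvgD => //; exact: cvg_cst.
Qed.

(** One orbit is Cauchy, uniformly in the index, by comparison with its own shifts inside the box.
    Its limit [b] is fixed by continuity, and every other orbit in the box approaches [b], which is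
    its own orbit. *)
Lemma ratio_limit (d : nat) : (2 <= d <= 7)%N ->
  exists b, [/\ ratio_step d b = b, 0 <= b 0%N <= 1,
     forall i, 0 <= b i.+1 <= 1 / 2 &
     forall k (c : R) a, 0 <= c < 1 -> good_ratio k c a -> forall e : R, 0 < e ->
       \forall n \near \oo, let a' := iter n (ratio_step d) a in
         [/\ 0 <= a' 0%N <= 1, forall i, 0 <= a' i.+1 <= 1 / 2 & forall i, `|a' i - b i| <= e]].
Proof.
move=> hd; have [h [M [k ct]]] := @contracts_exist R _ hd.
have d2 : (2 <= d)%N by case/andP: hd.
move: (ct) => [k0 [/andP[M0 M1] h1] burn inv _].
have ibox a' m : box d h M a' -> box d h M (iter m (ratio_step d) a').
  by move=> b0; elim: m => [//|m IH]; exact: inv.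
have reach j (c : R) a : 0 <= c < 1 -> good_ratio j c a -> exists n, box d h M (iter n (ratio_step d) a).
  move=> c01 ga; have [n bn] := good_ratio_box_half _ d2 _ _ _ c01 ga.
  by have [m bm] := burn _ bn; exists (m + n)%N; rewrite iterD.
(* The zero sequence is the ratio sequence of the weight concentrated at 0. *)
have [n0 bs] : exists n, box d h M (iter n (ratio_step d) (fun _ => 0)).
  by apply: (reach 0%N 0) => //; [lra|split=> // i _; lra].
set s := iter n0 _ _ in bs.
set K := (10 + k) * (1 + k^-1).
pose u n := iter n (ratio_step d) s.
have ub n : box d h M (u n) by exact: ibox.
have uD n m i : (n <= m)%N -> `|u n i - u m i| <= K * (199 / 200) ^+ n.
  move=> nm; rewrite /u -(subnKC nm) iterD.
  by apply: (box_iter_close _ _ _ _ _ _ _ ct) => //; exact: ibox.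
have ucvg i : cvg (u ^~ i @ \oo).
  apply/cauchy_cvgP/cauchy_exP => e e0.
  have e20 : 0 < e / 2 by apply: divr_gt0.
  have [N _ hN] := geometric_small K _ e20.
  exists (u N i); exists N => // m /= Nm; rewrite /ball/=.
  by apply: le_lt_trans (uD _ _ i Nm) _; apply: le_lt_trans (hN N (leqnn _)) _; lra.
pose b i := lim (u ^~ i @ \oo).
have ulim i : u ^~ i @ \oo --> b i by exact: ucvg.
have bbox : box d h M b.
  split; last first.
    move=> i; apply/andP; split.
      by apply: (cvgr_to_ge (ulim i.+1)); near=> n; have [_ /(_ i) /andP[]] := ub n.
    by apply: (cvgr_to_le (ulim i.+1)); near=> n; have [_ /(_ i) /andP[]] := ub n.
  apply/andP; split.
    by apply: (cvgr_to_ge (ulim 0%N)); near=> n; have [/andP[]] := ub n.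
  by apply: (cvgr_to_le (ulim 0%N)); near=> n; have [/andP[]] := ub n.
have l0 : 0 < ((2 / 3) ^+ d : R) by apply: exprn_gt0; lra.
have ran a' : box d h M a' -> 0 <= a' 0%N <= 1 /\ forall i, 0 <= a' i.+1 <= 1 / 2.
  by move=> [a0 ai]; split=> [|i]; [lra|have := ai i; lra].
have [b0 b1] := ran _ bbox.
have bfix : ratio_step d b = b.
  apply/funext => i.
  have c1 : (fun n => ratio_step d (u n) i) @ \oo --> ratio_step d b i.
    by apply: cvg_ratio_step => // -[|j]; [lra|have := b1 j; lra].
  have c2 : (fun n => u n.+1 i) @ \oo --> b i by rewrite (cvg_shiftS (u ^~ i)).
  exact: (cvg_unique _ c1 c2).
exists b; split => // j c a c01 ga e e0.
have [m bm] := reach _ _ _ c01 ga.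
have [N _ hN] := geometric_small K _ e0.
exists (N + m)%N => // n /= Nn; have mn : (m <= n)%N by apply: leq_trans Nn; exact: leq_addl.
have bn : box d h M (iter n (ratio_step d) a).
  by rewrite -(subnK mn) iterD; exact: ibox.
have [r0 r1] := ran _ bn; split => // i.
have bE p : b = iter p (ratio_step d) b.
  by elim: p => [//|p IH]; rewrite iterS -IH bfix.
rewrite (bE (n - m)%N) -{1}(subnK mn) iterD.
apply: le_trans (box_iter_close _ _ _ _ _ _ _ ct bm bbox i) _.
by apply: hN => /=; rewrite leq_subRL // addnC.
Unshelve. all: by end_near. Qed.
End Limit.

(** * Summation over the leaves *)

Set Implicit Arguments.
Section Tree.
Context {R : realType} (d : nat).
Implicit Types (w : int -> R).

Definition leaf_step w : int -> R := fun i => (w (i - 1) + w i + w (i + 1)) ^+ d.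

(** Evaluating at plain words, with default 0 outside the ball, lets functions on balls of different
    radii be compared without casts. *)
Definition val_at n (f : tfun n d) (s : seq 'I_d) : int :=
  if insub s is Some v then f v else 0.

Lemma val_atE n (f : tfun n d) (v : vtx n d) : val_at f (val v) = f v.
Proof. by rewrite /val_at valK. Qed.

Lemma val_at_ext n (f g : tfun n d) :
  (forall s, (size s <= n)%N -> val_at f s = val_at g s) -> f = g.
Proof. by move=> fg; apply/ffunP => v; rewrite -!val_atE fg // (valP v). Qed.

Lemma val_at_ffun n (F : seq 'I_d -> int) s : (size s <= n)%N ->
  val_at ([ffun v => F (val v)] : tfun n d) s = F s.
Proof. by move=> ns; rewrite /val_at insubT /= ffunE. Qed.

Lemma lipschitzE n (f : tfun n d) :
  Defs.lipschitz f <-> forall i s, (size s < n)%N -> `|val_at f s - val_at f (i :: s)| <= 1.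
Proof.
split=> [lf i s sn | lf u v].
  have s1 : (size s <= n)%N by exact: ltnW.
  have := lf (Sub s s1) (Sub (i :: s) sn).
  by rewrite -!val_atE !SubK; apply; rewrite /is_child /= !eqxx.
rewrite /is_child -!val_atE; case: (val v) (valP v) => [|i s] //= sn /andP[/eqP su /eqP <-].
exact: lf.
Qed.

Lemma leaf_prod n (F : seq 'I_d -> R) :
  \prod_(v : vtx n d | is_leaf v) F (val v) = \prod_(t : n.-tuple 'I_d) F (val t).
Proof.
rewrite (reindex_omap (fun t : n.-tuple 'I_d => bseq_of_tuple t) (fun v => insub (val v))).
  apply: eq_bigl => t /=; rewrite /is_leaf /= size_tuple eqxx /=.
  by rewrite valK eqxx.
move=> v; rewrite /is_leaf => vn; rewrite insubT /=; congr Some; exact: val_inj.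
Qed.

Lemma leaf_prodS n (F : seq 'I_d -> R) :
  \prod_(t : n.+1.-tuple 'I_d) F (val t) =
  \prod_(k : n.-tuple 'I_d * 'I_d) F (k.2 :: val k.1).
Proof.
rewrite (reindex (fun k : n.-tuple 'I_d * 'I_d => [tuple of k.2 :: k.1])) //=.
exists (fun t : n.+1.-tuple 'I_d => ([tuple of behead t], thead t)) => [[t i] _|t _] /=.
  by congr pair; apply: val_inj.
by rewrite -tuple_eta.
Qed.

Lemma weightE n w (f : tfun n d) :
  weight w f = \prod_(t : n.-tuple 'I_d) w (val_at f (val t)).
Proof.
rewrite -(leaf_prod n (fun s => w (val_at f s))).
by apply: eq_bigr => v _; rewrite val_atE.
Qed.

Definition restr n (f : tfun n.+1 d) : tfun n d := [ffun v => val_at f (val v)].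

(* [e (t, i) - 1] is the increment from the leaf [t] to its child [i :: t]. *)
Definition extend_val n (h : tfun n d) (e : {ffun n.-tuple 'I_d * 'I_d -> 'I_3})
    (s : seq 'I_d) : int :=
  if (size s <= n)%N then val_at h s
  else if s is i :: u then
    val_at h u + oapp (fun t => (e (t, i) : nat)%:Z) 0 (insub u) - 1
  else 0.

Definition extend n (h : tfun n d) (e : {ffun n.-tuple 'I_d * 'I_d -> 'I_3}) :
  tfun n.+1 d := [ffun v => extend_val h e (val v)].

Lemma val_at_restr n (f : tfun n.+1 d) s : (size s <= n)%N ->
  val_at (restr f) s = val_at f s.
Proof. by move=> sn; rewrite /restr (val_at_ffun _ (val_at f)). Qed.

Lemma val_at_extend n h e s : (size s <= n)%N -> val_at (@extend n h e) s = val_at h s.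
Proof.
by move=> sn; rewrite /extend (val_at_ffun _ (extend_val h e)) ?leqW // /extend_val sn.
Qed.

Lemma val_at_extendS n h e i (t : n.-tuple 'I_d) :
  val_at (@extend n h e) (i :: t) = val_at h t + (e (t, i) : nat)%:Z - 1.
Proof.
rewrite /extend (val_at_ffun _ (extend_val h e)) /= ?size_tuple //.
by rewrite /extend_val /= size_tuple ltnn valK.
Qed.

Lemma restr_extend n h e : restr (@extend n h e) = h.
Proof.
by apply: val_at_ext => s sn; rewrite val_at_restr // val_at_extend.
Qed.

Lemma extend_inj n h h' e e' : @extend n h e = extend h' e' -> h = h' /\ e = e'.
Proof.
move=> eq; have hh : h = h' by rewrite -(restr_extend h e) eq restr_extend.
split=> //; apply/ffunP => -[t i]; apply/val_inj => /=.
have := val_at_extendS h e i t; rewrite eq val_at_extendS hh => /eqP; lia.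
Qed.

Lemma lip_extend n h e : Defs.lipschitz h -> Defs.lipschitz (@extend n h e).
Proof.
move=> /lipschitzE lh; apply/lipschitzE => i s; rewrite ltnS leq_eqVlt => /orP[/eqP sn|sn].
  have -> : s = tcast sn (in_tuple s) by rewrite val_tcast.
  rewrite val_at_extendS val_at_extend ?size_tuple //.
  by have := ltn_ord (e (tcast sn (in_tuple s), i)); lia.
by rewrite !val_at_extend ?(ltnW sn) //; exact: lh.
Qed.

Lemma lip_restr n (f : tfun n.+1 d) : Defs.lipschitz f -> Defs.lipschitz (restr f).
Proof.
move=> /lipschitzE lf; apply/lipschitzE => i s sn.
by rewrite !val_at_restr ?(ltnW sn) //; apply: lf; exact: leqW.
Qed.

Lemma lip_extendP n (f : tfun n.+1 d) : Defs.lipschitz f -> exists e, f = extend (restr f) e.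
Proof.
move=> /lipschitzE lf.
(* The increments -1, 0, 1 are shifted to 0, 1, 2; the Lipschitz bound keeps [inord] off its default
   value. *)
exists [ffun k => inord (absz (val_at f (k.2 :: val k.1) - val_at f (val k.1) + 1))].
apply: val_at_ext => s; rewrite leq_eqVlt => /orP[/eqP sn|sn]; last first.
  by rewrite val_at_extend // val_at_restr.
case: s sn => // i s [sn].
have -> : s = tcast sn (in_tuple s) by rewrite val_tcast.
set t := tcast _ _; rewrite val_at_extendS ffunE val_at_restr ?size_tuple //=.
have := lf i t; rewrite size_tuple ltnSn => /(_ isT) l1.
by rewrite inordK; lia.
Qed.

(** Distributivity: the sum over all increments of a product over the new leaves is a product of
    sums of three terms, and the [d] children of each old leaf give the power [d]. *)
Lemma sum_weight_extend n w h :
  \sum_(e : {ffun n.-tuple 'I_d * 'I_d -> 'I_3}) weight w (extend h e) =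
  weight (leaf_step w) h.
Proof.
rewrite weightE.
under eq_bigr => e _.
  rewrite weightE (leaf_prodS n (fun s => w (val_at (extend h e) s))).
  under eq_bigr => k _ do rewrite val_at_extendS -surjective_pairing.
  over.
rewrite -(bigA_distr_bigA (fun (k : n.-tuple 'I_d * 'I_d) (o : 'I_3) =>
  w (val_at h k.1 + (o : nat)%:Z - 1))) /=.
rewrite -(pair_bigA _ (fun t i => \sum_(o < 3) w (val_at h (val t) + (o : nat)%:Z - 1))) /=.
apply: eq_bigr => t _; rewrite prodr_const card_ord /leaf_step; congr (_ ^+ _).
rewrite !big_ord_recl big_ord0 /= !addr0 addrA /bump /=.
by congr (_ + _ + _); congr (w _); lia.
Qed.

Lemma weight_ge0 n w (f : tfun n d) : (forall i, 0 <= w i) -> 0 <= weight w f.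
Proof. by move=> w0; apply: prodr_ge0. Qed.

(** A Lipschitz function on the larger ball is one on the smaller ball with free increments at the
    new leaves, so the sum splits and the inner sum is finite. *)
Lemma esum_leaf_step n w (P : set (tfun n d)) : (forall i, 0 <= w i) ->
  \esum_(f in Lip n.+1 d `&` [set f | P (restr f)]) (weight w f)%:E =
  \esum_(h in Lip n d `&` P) (weight (leaf_step w) h)%:E.
Proof.
move=> w0.
pose E := {ffun n.-tuple 'I_d * 'I_d -> 'I_3}.
rewrite (reindex_esum ((Lip n d `&` P) `*`` (fun=> [set: E])) _ (fun k => extend k.1 k.2)).
  rewrite -(esum_esum (a := fun h (e : E) => (weight w (extend h e))%:E)); last first.
    by move=> *; rewrite lee_fin weight_ge0.
  apply: eq_esum => h _; rewrite esum_fset; last 2 first.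
  - exact: finite_finset.
  - by move=> *; rewrite lee_fin weight_ge0.
  rewrite (_ : [set: E] = [set` (predT : {pred E})]); last by apply/seteqP.
  rewrite -(@fsbigop.bigfs _ _ _ _ (index_enum E)) ?index_enum_uniq //; last first.
    by move=> i _; rewrite mem_index_enum.
  by rewrite sumEFin sum_weight_extend.
split.
- move=> [h e] /= [[lh Ph] _]; split; first exact: lip_extend.
  by rewrite /= restr_extend.
- by move=> [h e] [h' e'] _ _ /= /extend_inj[-> ->].
- move=> f [lf Pf]; have [e fe] := lip_extendP lf.
  by exists (restr f, e) => //=; split=> //; split=> //; exact: lip_restr.
Qed.

Lemma restr_eqE n r (g : tfun r d) (f : tfun n d) : (r <= n)%N ->
  restr_eq g f <-> forall s, (size s <= r)%N -> val_at f s = val_at g s.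
Proof.
move=> rn; split=> [fg s sr | fg u v uv].
  have sn := leq_trans sr rn.
  by rewrite /val_at !insubT /=; apply: fg.
by rewrite -!val_atE -uv fg // (valP u).
Qed.

Lemma leaf_step_ge0 w : (forall i, 0 <= w i) -> forall i, 0 <= leaf_step w i.
Proof. by move=> w0 i; rewrite exprn_ge0 // !addr_ge0. Qed.

Lemma esum_weight0 w : (forall i, 0 <= w i) ->
  \esum_(f in Lip 0 d) (weight w f)%:E = \esum_(i in [set: int]) (w i)%:E.
Proof.
move=> w0; pose c (i : int) : tfun 0 d := [ffun=> i].
rewrite (reindex_esum setT _ c).
  apply: eq_esum => i _; rewrite weightE (big_pred1 [tuple]) /=.
    by rewrite /val_at insubT // /c ffunE.
  by move=> t /=; rewrite tuple0; apply/esym/eqP.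
have nil0 (v : vtx 0 d) : val v = [::] by apply/eqP; rewrite -size_eq0 -leqn0 (valP v).
split.
- by move=> i _ u v; rewrite /is_child !nil0.
- by move=> i j _ _ /ffunP /(_ (Sub [::] isT)); rewrite !ffunE.
- move=> f _; exists (f (Sub [::] isT)) => //.
  by apply/ffunP => v; rewrite ffunE; congr (f _); apply: val_inj; rewrite nil0.
Qed.

Lemma esum_weight n w : (forall i, 0 <= w i) ->
  \esum_(f in Lip n d) (weight w f)%:E =
  \esum_(i in [set: int]) (iter n leaf_step w i)%:E.
Proof.
elim: n w => [|n IH] w w0; first exact: esum_weight0.
have := @esum_leaf_step n w setT w0; rewrite !setIT => ->.
by rewrite IH ?iterSr //; exact: leaf_step_ge0.
Qed.

(** Leaves are peeled off [m] times until the ball has radius [r]; there the constraint admits only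
    [g] itself, provided it is Lipschitz. *)
Lemma esum_weight_restr m r (g : tfun r d) w : (forall i, 0 <= w i) ->
  \esum_(f in Lip (m + r) d `&` @restr_eq (m + r) d r g) (weight w f)%:E =
  (if `[< Defs.lipschitz g >] then weight (iter m leaf_step w) g else 0)%:E.
Proof.
elim: m w => [|m IH] w w0.
  have eqg (f : tfun r d) : restr_eq g f <-> f = g.
    split=> [fg|-> u v /val_inj -> //]; apply/ffunP => v; exact: fg.
  case: asboolP => lg.
    rewrite (_ : _ `&` _ = [set g]) ?esum_set1 ?lee_fin ?weight_ge0 //.
    by apply/seteqP; split=> [f [_ /eqg]|f -> ] //; split=> //; exact/eqg.
  rewrite (_ : _ `&` _ = set0) ?esum_set0 //.
  by apply/seteqP; split=> // f [lf /eqg fg]; apply: lg; rewrite -fg.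
rewrite iterSr -IH; last exact: leaf_step_ge0.
rewrite -esum_leaf_step //; congr esum; apply/seteqP; split=> f [lf fg]; split=> //.
  apply/restr_eqE => [|s sr]; first exact: leq_addl.
  rewrite val_at_restr ?(leq_trans sr) ?leq_addl //.
  by move/restr_eqE: fg => ->//; exact: leq_trans (leq_addl _ _) (leqnSn _).
apply/restr_eqE => [|s sr]; first exact: leq_trans (leq_addl _ _) (leqnSn _).
move/restr_eqE: fg => /(_ (leq_addl _ _) s sr) <-.
by rewrite val_at_restr // (leq_trans sr) // leq_addl.
Qed.

End Tree.

(** * From ratios to weights *)

Section Profile.
Context {R : realType}.
Implicit Types (a b : nat -> R) (w : int -> R).

Definition profile a (i : int) : R := \prod_(j < absz i) a j.

Lemma profileS a (n : nat) : profile a n.+1 = profile a n * a n.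
Proof. by rewrite /profile /= big_ord_recr. Qed.

Lemma profileN a (i : int) : profile a (- i) = profile a i.
Proof. by rewrite /profile abszN. Qed.

Lemma profile0 a : profile a 0 = 1.
Proof. by rewrite /profile big_ord0. Qed.

Lemma profile1 a : profile a 1 = a 0%N.
Proof. by rewrite /profile big_ord1. Qed.

Lemma profile_ge0 a : (forall j, 0 <= a j) -> forall i, 0 <= profile a i.
Proof. by move=> a0 i; apply: prodr_ge0. Qed.

(** Both sides agree at 0, where the value is the prefactor, and have the same successive ratios;
    negative arguments follow by symmetry. *)
Lemma leaf_step_profile d a : (forall j, 0 <= a j) ->
  forall i, leaf_step d (profile a) i = (1 + 2 * a 0%N) ^+ d * profile (ratio_step d a) i.
Proof.
move=> a0.
have PS (n : nat) : profile a (n%:Z + 1) = profile a n * a n.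
  by rewrite -profileS; congr profile; lia.
have LS n : leaf_step d (profile a) n.+1%:Z = leaf_step d (profile a) n%:Z * ratio_step d a n.
  rewrite /leaf_step PS (_ : n.+1%:Z - 1 = n%:Z); last by lia.
  case: n => [|n] /=; rewrite -exprMn; congr (_ ^+ _).
    rewrite sub0r add0r profileN profile1 profile0 /ratio0; field.
    by have a00 := a0 0%N; rewrite gt_eqF //; lra.
  rewrite PS !profileS (_ : n.+1%:Z - 1 = n%:Z); last by lia.
  have p := mulr_ge0 (a0 n) (a0 n.+1); have q := a0 n.
  rewrite /ratioS; field.
  by rewrite gt_eqF //; lra.
suff nat_case (n : nat) : leaf_step d (profile a) n%:Z =
    (1 + 2 * a 0%N) ^+ d * profile (ratio_step d a) n%:Z.
  case=> n; first exact: nat_case.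
  rewrite NegzE profileN -nat_case /leaf_step; congr (_ ^+ _).
  rewrite (_ : - n.+1%:Z - 1 = - (n.+1%:Z + 1)); last by lia.
  rewrite (_ : - n.+1%:Z + 1 = - (n.+1%:Z - 1)); last by lia.
  by rewrite !profileN; ring.
elim: n => [|n IH]; last by rewrite LS IH profileS mulrA.
rewrite /leaf_step sub0r add0r profileN profile1 !profile0.
by rewrite mulr1; congr (_ ^+ _); ring.
Qed.

(** * Summable profiles and continuity of their total mass *)

Lemma esumZ (T : choiceType) (P : set T) (c : R) (f : T -> R) : 0 < c ->
  (forall i, 0 <= f i) ->
  \esum_(i in P) (c * f i)%:E = (c%:E * \esum_(i in P) (f i)%:E)%E.
Proof.
move=> c0 f0; rewrite -ereal_supZl ?ltW //; last by apply/set0P; exists 0%E; exists set0; rewrite ?fsbig_set0//; exact: fsets_set0.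
congr ereal_sup; apply/seteqP; split => [_ [X XP <-]|_ [_ [X XP <-] <-]] /=.
  exists (\sum_(i \in X) (f i)%:E)%E; first by exists X.
  rewrite ge0_mule_fsumr; last by move=> i; rewrite lee_fin.
  by apply: eq_fsbigr => i _; rewrite EFinM.
exists X => //; rewrite ge0_mule_fsumr; last by move=> i; rewrite lee_fin.
by apply: eq_fsbigr => i _; rewrite EFinM.
Qed.
(** A summable majorant. Its rate exceeds the rate [1 / 2] of tame profiles, which leaves room for
    accumulated errors. *)
Definition geo (i : int) : R := (3 / 4) ^+ absz i.
Lemma geo_ge0 i : 0 <= geo i.
Proof. by apply: exprn_ge0; lra. Qed.

Lemma esum_geo_lty : (\esum_(i in [set: int]) (geo i)%:E < +oo)%E.
Proof.
have nat_case : (\esum_(n in [set: nat]) ((3 / 4 : R) ^+ n)%:E <= 4%:E)%E.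
  have p0 n : (0 <= ((3 / 4 : R) ^+ n)%:E)%E by rewrite lee_fin exprn_ge0 //; lra.
  rewrite -nneseries_esumT //; apply: lime_le; first exact: is_cvg_nneseries.
  have sumE n : \sum_(i < n) (3 / 4 : R) ^+ i = 4 * (1 - (3 / 4) ^+ n).
    elim: n => [|n IH]; first by rewrite big_ord0 expr0 subrr mulr0.
    by rewrite big_ord_recr /= IH exprS; field.
  near=> n; rewrite sumEFin lee_fin big_mkord sumE.
  have : 0 <= (3 / 4 : R) ^+ n by apply: exprn_ge0; lra.
  lra.
rewrite (esumID (range Posz)) => [|i _]; last by rewrite lee_fin geo_ge0.
rewrite !setTI.
have -> : ~` range Posz = range Negz.
  apply/seteqP; split=> [[n|n] H|_ [n _ <-] [m _]] //=; last by exists n.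
  by case: H; exists n.
rewrite !esum_image; last 2 first.
- by move=> x y _ _ [].
- by move=> x y _ _ [].
apply: (@le_lt_trans _ _ (4%:E + 4%:E)%E); last by rewrite -EFinD ltry.
apply: leeD; first exact: nat_case.
apply: le_trans nat_case; apply: le_esum => n _.
rewrite lee_fin /geo /= exprS ler_piMl //; lra.
Unshelve. all: by end_near. Qed.

Definition total a : R := fine (\esum_(i in [set: int]) (profile a i)%:E).

Definition tame a : Prop := 0 <= a 0%N <= 1 /\ forall i, 0 <= a i.+1 <= 1 / 2.

Lemma tame_ge0 a : tame a -> forall i, 0 <= a i.
Proof. by move=> [/andP[a0 _] ai] [|i] //; case/andP: (ai i). Qed.

Lemma profile_le_half a : tame a -> forall n : nat, profile a n.+1 <= (1 / 2) ^+ n.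
Proof.
move=> ta; have a0 := tame_ge0 ta; case: (ta) => [/andP[_ a01] ai].
elim=> [|n IH]; first by rewrite profile1 expr0.
rewrite profileS exprSr; apply: ler_pM => //; first exact: profile_ge0.
by case/andP: (ai n).
Qed.

(** Induction on the distance to 0: the new error is at most half the old one plus [e] times the
    profile, and [8 / 2 + 4 / 3 <= 8 * (3 / 4)] closes it. *)
Lemma profile_close a b (e : R) : tame a -> tame b -> (forall i, `|a i - b i| <= e) ->
  forall i, `|profile a i - profile b i| <= 8 * e * geo i.
Proof.
move=> ta tb ab; have e0 : 0 <= e by apply: le_trans (ab 0%N).
have a0 := tame_ge0 ta; have b0 := tame_ge0 tb.
suff nat_case (n : nat) : `|profile a n - profile b n| <= 8 * e * geo n.
  by case=> n; [exact: nat_case|rewrite NegzE !profileN /geo abszN; exact: nat_case].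
have split_diff m : `|profile a m.+1 - profile b m.+1| <=
    `|profile a m - profile b m| * a m + profile b m * e.
  rewrite !profileS (_ : _ - _ = (profile a m - profile b m) * a m + profile b m * (a m - b m)); last by ring.
  apply: (le_trans (ler_normD _ _)); rewrite !normrM (ger0_norm (a0 m)).
  rewrite (ger0_norm (profile_ge0 b b0 m)) lerD2l ler_wpM2l //; exact: profile_ge0.
elim: n => [|[|n] IH].
- by rewrite !profile0 subrr normr0 /geo expr0; lra.
- by rewrite !profile1 /geo expr1; have := ab 0%N; lra.
apply: (le_trans (split_diff _)).
have g0 := geo_ge0 n.+1; have gS : geo n.+2 = 3 / 4 * geo n.+1 by rewrite /geo /= exprS.
have h1 : profile b n.+1 * e <= 4 / 3 * geo n.+1 * e.
  apply: ler_wpM2r => //; apply: (le_trans (profile_le_half tb n)).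
  rewrite /geo /= exprS mulrA (_ : 4 / 3 * (3 / 4) = 1) ?mul1r; last by field.
  by apply: lerXn2r; rewrite ?nnegrE; lra.
have h2 : `|profile a n.+1 - profile b n.+1| * a n.+1 <= 8 * e * geo n.+1 * (1 / 2).
  by apply: ler_pM => //; have [_ /(_ n) /andP[]] := ta.
have h3 : 0 <= e * geo n.+1 by exact: mulr_ge0.
rewrite gS; lra.
Qed.

Lemma esum_profile_lty a : tame a -> (\esum_(i in [set: int]) (profile a i)%:E < +oo)%E.
Proof.
move=> ta; apply: (@le_lt_trans _ _ (\esum_(i in [set: int]) (2 * geo i)%:E)%E).
  apply: le_esum => i _; rewrite lee_fin.
  suff nat_case (n : nat) : profile a n <= 2 * geo n.
    by case: i => n; [exact: nat_case|rewrite NegzE profileN /geo abszN; exact: nat_case].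
  case: n => [|n]; first by rewrite profile0 /geo expr0; lra.
  apply: (le_trans (profile_le_half ta n)); rewrite /geo /= exprS.
  have g0 := geo_ge0 n; rewrite /geo /= in g0.
  apply: (@le_trans _ _ ((3 / 4) ^+ n)); last lra.
  by apply: lerXn2r; rewrite ?nnegrE; lra.
rewrite esumZ //; last exact: geo_ge0.
have := esum_geo_lty; have : (0 <= \esum_(i in [set: int]) (geo i)%:E)%E.
  by apply: esum_ge0 => i _; rewrite lee_fin geo_ge0.
by case: (\esum_(i in _) _)%E => [x _ _||] //; rewrite -EFinM ltry.
Qed.

Lemma totalE a : tame a ->
  (\esum_(i in [set: int]) (profile a i)%:E = (total a)%:E)%E.
Proof.
move=> ta; rewrite /total fineK // ge0_fin_numE ?esum_profile_lty //.
by apply: esum_ge0 => i _; rewrite lee_fin profile_ge0 //; exact: tame_ge0.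
Qed.

(** The term at 0 is already 1; this keeps the normalization away from 0. *)
Lemma total_ge1 a : tame a -> 1 <= total a.
Proof.
move=> ta; rewrite -lee_fin -totalE //; apply: esum_ge.
exists [set 0 : int]; first by split=> //; exact: finite_set1.
by rewrite fsbig_set1 profile0.
Qed.

Lemma total_le a b (c : R) : 0 < c -> tame a -> tame b ->
  (forall i, profile a i <= profile b i + c * geo i) ->
  total a <= total b + c * fine (\esum_(i in [set: int]) (geo i)%:E).
Proof.
move=> c0 ta tb ab; have b0 := tame_ge0 tb.
rewrite -lee_fin EFinD EFinM -!totalE // fineK; last first.
  rewrite ge0_fin_numE ?esum_geo_lty //.
  by apply: esum_ge0 => i _; rewrite lee_fin geo_ge0.
rewrite -esumZ //; last exact: geo_ge0.
rewrite -esumD.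
- by apply: le_esum => i _; rewrite -EFinD lee_fin.
- by move=> i _; rewrite lee_fin profile_ge0.
- by move=> i _; rewrite lee_fin mulr_ge0 ?geo_ge0 // ltW.
Qed.

(** Closeness uniform in [i] gives an error dominated by a small multiple of [geo], hence a small
    error in the sum. *)
Lemma cvg_total (u : nat -> nat -> R) b : tame b ->
  (\forall n \near \oo, tame (u n)) ->
  (forall e : R, 0 < e -> \forall n \near \oo, forall i, `|u n i - b i| <= e) ->
  (fun n => total (u n)) @ \oo --> total b.
Proof.
move=> tb tu ub; set Q := fine (\esum_(i in [set: int]) (geo i)%:E).
have Q0 : 0 <= Q by apply: fine_ge0; apply: esum_ge0 => i _; rewrite lee_fin geo_ge0.
apply/cvgrPdist_le => e e0.
have e1 : 0 < e / (8 * (Q + 1)) by apply: divr_gt0 => //; lra.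
have h := ub _ e1; near=> n.
have tn : tame (u n) by near: n.
have un i : `|u n i - b i| <= e / (8 * (Q + 1)) by move: i; near: n.
have eQ : 8 * (e / (8 * (Q + 1))) * Q <= e.
  rewrite (_ : 8 * _ * Q = e * (Q / (Q + 1))); last by field; rewrite gt_eqF //; lra.
  have Q1 : Q / (Q + 1) <= 1 by rewrite ler_pdivrMr; lra.
  by rewrite ler_piMr // ltW.
have c0 : 0 < 8 * (e / (8 * (Q + 1))) by apply: mulr_gt0.
have close i := @profile_close _ _ _ tn tb un i.
have l1 : total (u n) <= total b + 8 * (e / (8 * (Q + 1))) * Q.
  by apply: total_le => // i; have := close i; rewrite ler_norml => /andP[_]; lra.
have l2 : total b <= total (u n) + 8 * (e / (8 * (Q + 1))) * Q.
  by apply: total_le => // i; have := close i; rewrite ler_norml => /andP[+ _]; lra.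
by rewrite ler_norml; apply/andP; split; lra.
Unshelve. all: by end_near. Qed.

(** * The law near the root as a function of the ratios *)

Fixpoint growth (d r : nat) a : R :=
  if r is r'.+1 then (growth d r' a * (1 + 2 * iter r' (ratio_step d) a 0%N)) ^+ d
  else 1.

Lemma ratio_step_ge0 d a : (forall j, 0 <= a j) -> forall j, 0 <= ratio_step d a j.
Proof.
move=> a0 [|j] /=; apply: exprn_ge0; last exact: ratioS_ge0.
have p := mulr_ge0 (a0 0%N) (a0 1%N); have q := a0 0%N.
by apply: divr_ge0; lra.
Qed.

Lemma iter_ratio_step_ge0 d a n : (forall j, 0 <= a j) ->
  forall j, 0 <= iter n (ratio_step d) a j.
Proof. by move=> a0; elim: n => [//|n IH]; exact: ratio_step_ge0. Qed.

Lemma growth_gt0 d r a : (forall j, 0 <= a j) -> 0 < growth d r a.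
Proof.
move=> a0; elim: r => [//|r IH] /=; apply: exprn_gt0; apply: mulr_gt0 => //.
by have := iter_ratio_step_ge0 d a r a0 0%N; lra.
Qed.

Lemma leaf_stepZ d (l : R) w i : leaf_step d (fun i => l * w i) i = l ^+ d * leaf_step d w i.
Proof. by rewrite /leaf_step -!mulrDr exprMn. Qed.

Lemma iter_leaf_stepZ d r (l : R) w :
  iter r (leaf_step d) (fun i => l * w i) = (fun i => l ^+ (d ^ r) * iter r (leaf_step d) w i).
Proof.
elim: r => [|r IH]; first by rewrite expn0 expr1.
by apply/funext => i; rewrite !iterS IH leaf_stepZ -exprM expnSr.
Qed.

Lemma iter_leaf_step_profile d r a : (forall j, 0 <= a j) ->
  iter r (leaf_step d) (profile a) =
  (fun i => growth d r a * profile (iter r (ratio_step d) a) i).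
Proof.
move=> a0; elim: r => [|r IH]; first by apply/funext => i /=; rewrite mul1r.
apply/funext => i; rewrite iterS IH leaf_stepZ leaf_step_profile; last exact: iter_ratio_step_ge0.
by rewrite mulrA /= exprMn.
Qed.

Lemma weightZ d n (l : R) w (f : tfun n d) :
  weight (fun i => l * w i) f = l ^+ (d ^ n) * weight w f.
Proof.
rewrite !weightE big_split /= prodr_const; congr (_ ^+ _ * _).
by rewrite card_tuple card_ord.
Qed.

(** The law on the ball of radius [r] with weight [profile b] on its leaves; the denominator is the
    total weight, computed by peeling off all [r] levels. *)
Definition local_law (d r : nat) (b : nat -> R) (g : tfun r d) : R :=
  (if `[< Defs.lipschitz g >] then weight (profile b) g else 0) /
  (growth d r b * total (iter r (ratio_step d) b)).

(** After [m] peelings the weight is [q * profile b]. The numerator stops there, the denominator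
    takes [r] more steps, and the factor [q ^+ (d ^ r)] cancels. *)
Lemma muw_profile d (m r : nat) a (l : R) (g : tfun r d) : 0 < l -> (forall j, 0 <= a j) ->
  tame (iter (m + r) (ratio_step d) a) ->
  muw (fun i => l * profile a i) (m + r) g = local_law (iter m (ratio_step d) a) g.
Proof.
move=> l0 a0 ta; have w0 i : 0 <= l * profile a i by rewrite mulr_ge0 ?profile_ge0 // ltW.
set b := iter m (ratio_step d) a; have b0 : forall j, 0 <= b j by exact: iter_ratio_step_ge0.
set q := l ^+ (d ^ m) * growth d m a.
have q0 : 0 < q by rewrite mulr_gt0 ?exprn_gt0 ?growth_gt0.
have vE : iter m (leaf_step d) (fun i => l * profile a i) = (fun i => q * profile b i).
  rewrite iter_leaf_stepZ iter_leaf_step_profile //.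
  by apply/funext => i; rewrite mulrA.
rewrite /muw esum_weight_restr // esum_weight // [(m + r)%N]addnC iterD vE.
rewrite iter_leaf_stepZ iter_leaf_step_profile // weightZ.
have g0 := growth_gt0 d r b b0.
under eq_esum do rewrite mulrA.
rewrite esumZ; last 2 first.
- by rewrite mulr_gt0 ?exprn_gt0.
- by move=> i; rewrite profile_ge0 //; exact: iter_ratio_step_ge0.
have tb : tame (iter r (ratio_step d) b) by rewrite /b -iterD addnC.
rewrite totalE // -EFinM /= /local_law.
have t1 := total_ge1 tb.
case: asboolP => _; last by rewrite !mul0r.
by field; rewrite !gt_eqF ?exprn_gt0 //; lra.
Qed.

End Profile.

(** * Good weights, windows and convergence of the local laws *)

Section LocalLaw.
Context {R : realType}.
Implicit Types (a b : nat -> R) (w : int -> R).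

Lemma good_profile w : good w -> exists k c a l,
  [/\ 0 <= c < 1, good_ratio k c a, forall i, 0 <= a i, 0 < l &
      w = fun i => l * profile a i].
Proof.
move=> [w0 ws wp [k [c [c0 c1 wk wc]]]].
exists k, c, (fun i : nat => w i.+1 / w i), (w 0).
have wpos (i : nat) : (i <= k)%N -> 0 < w i.
  by elim: i => [//|i IH] ik; rewrite -wk //; apply: IH; exact: ltnW.
(* Where [w i = 0] the quotient is 0 by convention; then [i] lies beyond the plateau and the decay
   forces [w i.+1 = 0] as well. *)
have wS (i : nat) : w i.+1 = w i * (w i.+1 / w i).
  have [wi0|wi] := eqVneq (w i) 0; last by rewrite mulrC divfK.
  have ki : (k <= i)%N by rewrite leqNgt; apply/negP => /ltnW/wpos; rewrite wi0 ltxx.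
  by have := wc i ki; have := w0 i.+1; rewrite wi0 mulr0 mul0r => ? ?; apply/eqP; rewrite eq_le; apply/andP.
split=> //; first by rewrite c0.
- split=> i ik; first by rewrite -wk // divff // gt_eqF // wpos // ltnW.
  rewrite divr_ge0 //=; have [->|wi] := eqVneq (w i) 0; first by rewrite invr0 mulr0.
  by rewrite ler_pdivrMr ?wc // lt_neqAle eq_sym wi /=.
- by move=> i; rewrite divr_ge0.
- apply/funext => i.
  have nat_case (n : nat) : w n = w 0 * profile (fun i : nat => w i.+1 / w i) n.
    by elim: n => [|n IH]; [rewrite profile0 mulr1|rewrite profileS mulrA -IH -wS].
  by case: i => n; [|rewrite NegzE ws opprK profileN]; exact: nat_case.
Qed.

(** The indicator of the allowed leaf values, a good weight with [c = 0]; it makes the uniform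
    measure a case of [muw]. *)
Definition window (k : nat) : int -> R := fun i => (`|i| <= k%:Z)%R%:R.

Lemma good_window k : good (window k).
Proof.
split=> [i|i||]; rewrite /window ?ler0n ?normrN ?normr0 ?ltr01 //.
exists k, 0; split=> // i ik.
  have -> : (`|i%:Z| <= k%:Z) = true by lia.
  by have -> : (`|i.+1%:Z| <= k%:Z) = true by lia.
have -> : (`|i.+1%:Z| <= k%:Z) = false by lia.
by rewrite mul0r.
Qed.

Lemma esum_Lipk (d k n : nat) (P : set (tfun n d)) :
  \esum_(f in Lipk n d k `&` P) (1%E : \bar R) =
  \esum_(f in Lip n d `&` P) (weight (window k) f)%:E.
Proof.
pose C : set (tfun n d) := [set f | forall v : vtx n d, is_leaf v -> `|f v| <= k%:Z].
have -> : Lipk n d k `&` P = (Lip n d `&` P) `&` C.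
  by apply/seteqP; split=> f [[]]; do ?[split].
rewrite esum_mkcondr; apply: eq_esum => f _; case: ifPn => [/set_mem fC|/negP fC].
  rewrite /weight big1 // => v lv; by rewrite /window (fC v lv).
have [v lv fv] : exists2 v : vtx n d, is_leaf v & ~~ (`|f v| <= k%:Z).
  apply: contrapT => nv; apply: fC; apply/mem_set => v lv.
  by apply: contrapT => /negP fv; apply: nv; exists v.
by rewrite /weight (bigD1 v) //= /window (negbTE fv) mul0r.
Qed.

Lemma muk_window (d k n r : nat) (g : tfun r d) : muk R k n g = muw (window k) n g.
Proof.
rewrite /muk /muw esum_Lipk; congr (_ / fine _).
by have := esum_Lipk k (@setT (tfun n d)); rewrite !setIT.
Qed.

(** Summing the numerator over all Lipschitz [g] reproduces the denominator. *)
Lemma local_law_prob (d r : nat) b : tame b -> tame (iter r (ratio_step d) b) ->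
  (forall g : tfun r d, 0 <= local_law b g) /\
  \esum_(g in [set: tfun r d]) (local_law b g)%:E = 1%E.
Proof.
move=> tb tr; have b0 := tame_ge0 tb; have p0 := profile_ge0 b b0.
have q0 : 0 < growth d r b * total (iter r (ratio_step d) b).
  by rewrite mulr_gt0 ?growth_gt0 //; have := total_ge1 tr; lra.
set q := _ * _ in q0; have qV : 0 < q^-1 by rewrite invr_gt0.
split=> [g|].
  by apply: divr_ge0; [case: ifP => // _; exact: weight_ge0|exact: ltW].
transitivity (\esum_(g in Lip r d) (q^-1 * weight (profile b) g)%:E).
  rewrite [RHS]esum_mkcond; apply: eq_esum => g _; rewrite /local_law -/q mulrC.
  case: ifPn => [/asboolP lg|/asboolP lg]; first by rewrite ifT //; exact/mem_set.
  by rewrite ifF ?mulr0 //; apply/negP => /set_mem.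
rewrite esumZ //; last by move=> g; exact: weight_ge0.
rewrite esum_weight // iter_leaf_step_profile // esumZ ?growth_gt0 //; last first.
  by move=> i; rewrite profile_ge0 //; exact: tame_ge0.
by rewrite totalE // -!EFinM mulVf // gt_eqF.
Qed.

Lemma cvg_prodr (T : Type) (s : seq T) (P : pred T) (f : T -> nat -> R) (l : T -> R) :
  (forall t, f t @ \oo --> l t) ->
  (fun n => \prod_(t <- s | P t) f t n) @ \oo --> \prod_(t <- s | P t) l t.
Proof.
move=> fl; elim: s => [|t s IH].
  rewrite big_nil; under eq_fun do rewrite big_nil; exact: cvg_cst.
rewrite big_cons; under eq_fun do rewrite big_cons.
by case: (P t) => //; apply: cvgM.
Qed.

Lemma cvg_iter_ratio_step d (u : nat -> nat -> R) b r : (forall i, 0 <= b i) ->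
  (forall i, u ^~ i @ \oo --> b i) ->
  forall i, (fun n => iter r (ratio_step d) (u n) i) @ \oo --> iter r (ratio_step d) b i.
Proof.
move=> b0 ub; elim: r => [//|r IH] i.
apply: (@cvg_ratio_step R d (fun n => iter r (ratio_step d) (u n))) => //.
exact: iter_ratio_step_ge0.
Qed.

Lemma cvg_growth d (u : nat -> nat -> R) b r : (forall i, 0 <= b i) ->
  (forall i, u ^~ i @ \oo --> b i) ->
  (fun n => growth d r (u n)) @ \oo --> growth d r b.
Proof.
move=> b0 ub; elim: r => [|r IH] /=; first exact: cvg_cst.
apply: cvg_exprn; apply: cvgM => //; apply: cvgD; first exact: cvg_cst.
by apply: cvgM; [exact: cvg_cst|exact: cvg_iter_ratio_step].
Qed.

(** Apart from [total], which depends on infinitely many ratios and whose convergence is therefore a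
    hypothesis, every factor is a finite expression in the ratios. *)
Lemma cvg_local_law d (u : nat -> nat -> R) b r (g : tfun r d) : tame b ->
  tame (iter r (ratio_step d) b) ->
  (forall i, u ^~ i @ \oo --> b i) ->
  (fun n => total (iter r (ratio_step d) (u n))) @ \oo --> total (iter r (ratio_step d) b) ->
  (fun n => local_law (u n) g) @ \oo --> local_law b g.
Proof.
move=> tb tr ub ut; have b0 := tame_ge0 tb; apply: cvgM.
  case: asboolP => _; last exact: cvg_cst.
  by apply: cvg_prodr => v; apply: cvg_prodr.
apply: cvgV; last by apply: cvgM => //; exact: cvg_growth.
rewrite gt_eqF // mulr_gt0 ?growth_gt0 //; have := total_ge1 tr; lra.
Qed.
End LocalLaw.
Unset Implicit Arguments.

Theorem theorem2p6 (R : realType) (d : nat) (hd : (2 <= d <= 7)%N) :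
  exists nu : forall r : nat, tfun r d -> R,
    prob_family nu /\
    (forall w : int -> R, good w ->
       forall (r : nat) (g : tfun r d),
         (fun n : nat => muw w n g) @ \oo --> nu r g) /\
    (forall (k : nat) (r : nat) (g : tfun r d),
         (fun n : nat => muk R k n g) @ \oo --> nu r g).
Proof.
have [b [bfix b01 b12 blim]] := @ratio_limit R d hd.
have tb : tame b by [].
have bE r : iter r (ratio_step d) b = b by elim: r => [//|r IH]; rewrite iterS IH.
have key : forall w : int -> R, good w -> forall (r : nat) (g : tfun r d),
    (fun n : nat => muw w n g) @ \oo --> local_law b g.
  move=> w /good_profile[k [c [a [l [c01 ga a0 l0 ->]]]]] r g.
  pose u m := iter m (ratio_step d) a.
  have lim := blim k c a c01 ga.
  have ut : \forall n \near \oo, tame (u n).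
    by apply: filterS (lim 1 ltr01) => n [].
  have uc (e : R) : 0 < e -> \forall n \near \oo, forall i, `|u n i - b i| <= e.
    by move=> e0; apply: filterS (lim e e0) => n [].
  have ub i : u ^~ i @ \oo --> b i.
    apply/cvgrPdist_le => e e0; near=> n; rewrite distrC; move: i; near: n; exact: uc.
  have uD m : iter r (ratio_step d) (u m) = u (m + r)%N by rewrite addnC /u iterD.
  have cu : (fun m => local_law (u m) g) @ \oo --> local_law b g.
    apply: cvg_local_law => //; first by rewrite bE.
    rewrite bE; under eq_fun do rewrite uD.
    have : (fun n => total (u n)) @ \oo --> total b by exact: cvg_total.
    by rewrite -(cvg_shiftn r).
  (* At depth [m + r], [muw] is the local law of [u m], but only eventually, since [muw_profile]
     asks for a tame iterate. *)
  rewrite -(cvg_shiftn r); apply: cvg_trans cu; apply: near_eq_cvg.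
  have [N _ hN] := ut; exists N => // m /= Nm.
  apply/esym; apply: muw_profile => //; apply: hN => /=.
  exact: leq_trans (leq_addr _ _).
exists (fun r g => local_law b g); split; last split.
- by move=> r; apply: local_law_prob => //; rewrite bE.
- exact: key.
- move=> k r g; under eq_fun do rewrite muk_window.
  by apply: key; exact: good_window.
Unshelve. all: by end_near. Qed.
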